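(* Let $X$ be a proper geodesic $\mathrm{CAT}(-1)$ metric space having at least two points, whose boundary at infinity $\partial_\infty X$ is arcwise connected and which has extendible geodesics. Let $(H_\alpha)_{\alpha\in\mathcal A}$ be any family of (closed) balls or horoballs in $X$ with pairwise disjoint interiors, and let $\mu_0=1.534$. (1) For every $x\in X-\bigcup_{\alpha\in\mathcal A}H_\alpha$, there exists a geodesic ray starting from $x$ which avoids $H_\alpha[\mu_0]$ for every $\alpha\in\mathcal A$. (2) For every $\alpha_0\in\mathcal A$ such that $H_{\alpha_0}$ is a horoball, there exists a geodesic line starting from the point at infinity of $H_{\alpha_0}$ which avoids $H_\alpha[\mu_0]$ for every $\alpha\neq\alpha_0$.
   Context: A geodesic ray is an isometric map $[\iota_0,+\infty[\to X$, a geodesic line an isometric map $\mathbb R\to X$; a geodesic line starts from $\xi\in\partial_\infty X$ if $\gamma(-\infty)=\xi$. $X$ has extendible geodesics if every geodesic segment extends to a geodesic line. For $\xi\in\partial_\infty X$ the Busemann function is $\beta_\xi(x,y)=\lim_{t\to\infty}(d(x,\rho(t))-d(y,\rho(t)))$ for any geodesic ray $\rho$ converging to $\xi$. A horoball centered at $\xi$ is a set $H=\{y:\beta_\xi(x,y)\ge s\}$ (for some $x\in X$, $s\in\mathbb R$), and for $t\ge0$, $H[t]=\{y:\beta_\xi(x,y)\ge s+t\}$; its point at infinity is $\xi$. If $B$ is a closed ball of center $x$ and radius $r$, then $B[t]$ is the closed ball of center $x$ and radius $r-t$ for $t\le r$, and $B[t]=\emptyset$ for $t>r$. All balls and horoballs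 are closed. *)

(* Defs.v *)
From Stdlib Require Import Reals List.
Open Scope R_scope.

Section Geom.
Variable X : Type.
Variable d : X -> X -> R.

Definition is_metric : Prop :=
  (forall x y, 0 <= d x y) /\ (forall x y, d x y = 0 <-> x = y) /\
  (forall x y, d x y = d y x) /\ (forall x y z, d x z <= d x y + d y z).

Definition open_ball (x : X) (e : R) (y : X) : Prop := d x y < e.
Definition closed_ball (x : X) (r : R) (y : X) : Prop := d x y <= r.
Definition is_open (U : X -> Prop) : Prop :=
  forall x, U x -> exists e, 0 < e /\ forall y, open_ball x e y -> U y.
Definition metric_interior (A : X -> Prop) (x : X) : Prop :=
  exists e, 0 < e /\ forall y, open_ball x e y -> A y.

Definition is_compact (K : X -> Prop) : Prop :=
  forall (I : Type) (U : I -> X -> Prop), (forall i, is_open (U i)) ->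
    (forall x, K x -> exists i, U i x) ->
    exists l : list I, forall x, K x -> exists i, In i l /\ U i x.

Definition proper : Prop := forall x r, is_compact (closed_ball x r).

Definition isometric_on (c : R -> X) (a b : R) : Prop :=
  forall u v, a <= u <= b -> a <= v <= b -> d (c u) (c v) = Rabs (u - v).

Definition geodesic_segment (c : R -> X) (x y : X) : Prop :=
  isometric_on c 0 (d x y) /\ c 0 = x /\ c (d x y) = y.

Definition geodesic_space : Prop :=
  forall x y, exists c, geodesic_segment c x y.

Definition geodesic_ray (r : R -> X) : Prop :=
  forall u v, 0 <= u -> 0 <= v -> d (r u) (r v) = Rabs (u - v).
Definition geodesic_line (g : R -> X) : Prop :=
  forall u v, d (g u) (g v) = Rabs (u - v).

Definition asymptotic (r1 r2 : R -> X) : Prop :=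
  exists C, forall t, 0 <= t -> d (r1 t) (r2 t) <= C.

(** CAT(-1): comparison with the hyperbolic plane, via the hyperbolic law
    of cosines; for points p = c1 s on [x,y] and q = c2 t on [x,z], the
    comparison distance D satisfies
    cosh D = cosh s cosh t - sinh s sinh t cos(gamma), where gamma is the
    comparison angle at x: cos gamma = (cosh a cosh b - cosh c)/(sinh a sinh b). *)
Definition CAT_minus1 : Prop :=
  forall x y z c1 c2, x <> y -> x <> z ->
    geodesic_segment c1 x y -> geodesic_segment c2 x z ->
    forall s t, 0 <= s <= d x y -> 0 <= t <= d x z ->
      let a := d x y in let b := d x z in let c := d y z in
      let cosg := (cosh a * cosh b - cosh c) / (sinh a * sinh b) in
      cosh (d (c1 s) (c2 t)) <= cosh s * cosh t - sinh s * sinh t * cosg.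

Definition extendible_geodesics : Prop :=
  forall c a b, a <= b -> isometric_on c a b ->
    exists g, geodesic_line g /\ forall u, a <= u <= b -> g u = c u.

(** Boundary at infinity, modelled by geodesic rays from a basepoint x0
    (every point of the boundary is represented by a unique such ray in a
    proper CAT(-1) space), with the cone topology (= uniform convergence
    on compact sets of rays from x0). *)
Definition ray_from (x0 : X) (r : R -> X) : Prop := geodesic_ray r /\ r 0 = x0.

Definition cone_continuous (x0 : X) (p : R -> R -> X) : Prop :=
  forall u, 0 <= u <= 1 -> forall T eps, 0 < eps ->
    exists delta, 0 < delta /\ forall v, 0 <= v <= 1 -> Rabs (v - u) < delta ->
      forall t, 0 <= t <= T -> d (p v t) (p u t) < eps.

Definition boundary_arcwise_connected : Prop :=
  exists x0, forall r1 r2, geodesic_ray r1 -> geodesic_ray r2 ->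
    ~ asymptotic r1 r2 ->
    exists p : R -> R -> X,
      (forall u, 0 <= u <= 1 -> ray_from x0 (p u)) /\
      cone_continuous x0 p /\
      (forall u v, 0 <= u <= 1 -> 0 <= v <= 1 -> u <> v ->
         ~ asymptotic (p u) (p v)) /\
      asymptotic (p 0) r1 /\ asymptotic (p 1) r2.

Definition busemann_lim (r : R -> X) (x y : X) (b : R) : Prop :=
  forall eps, 0 < eps -> exists T, forall t, T <= t ->
    Rabs (d x (r t) - d y (r t) - b) < eps.

Inductive shape : Type :=
| Ball : X -> R -> shape
| Horo : (R -> X) -> X -> R -> shape. (* {y | beta_xi(x,y) >= s}, xi = r(+oo) *)

Definition valid_shape (h : shape) : Prop :=
  match h with
  | Ball _ r => 0 <= r
  | Horo r _ _ => geodesic_ray r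
  end.

Definition shape_set (h : shape) (t : R) (y : X) : Prop :=
  match h with
  | Ball x r => t <= r /\ d x y <= r - t
  | Horo rho x s => exists b, busemann_lim rho x y b /\ s + t <= b
  end.

End Geom.

Arguments Ball {X}.
Arguments Horo {X}.

Definition mu0 : R := 1534 / 1000.

(* Main.v *)
(* Measure the signed depth f of a point in each ball or horoball.  Depth functions are 1-Lipschitz
   and quasi-concave along geodesics, and disjointness of the interiors says that where one depth
   is s > 0 all others are at most -s.

   Fix the origin x and start from any ray.  If it goes deeper than m = 6/5 somewhere, take the first
   shape where it does so and use the path of boundary points to deflect it to a ray whose maximal
   depth there is exactly m.  Both rays meet the convex set {f >= m}, whose nearest point p to x sees x
   under an angle at least pi/2; comparison with the hyperbolic plane bounds the distance of the two
   rays at time t by 2 exp (t - d(x,p)).  By disjointness, consecutive values of d(x,p) differ by at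
   least 11/5, so the corrections to earlier depths sum to at most 2 (1/8) / (1 - 1/8) = 2/7, and the
   limit ray has depth at most 6/5 + 2/7 < 1.534 everywhere.

   For (2), apply this from points tending to the center of the horoball: the deflections stay
   within 16/7 of the initial ray up to its exit from the horoball, so the rays accumulate on a
   geodesic line starting from the center. *)

Require Import Defs.
From Stdlib Require Import Reals Lra Lia List Classical ClassicalEpsilon.
From mathcomp Require filter.
Open Scope R_scope.

(** * Real inequalities *)

Lemma cosh_minus a b : cosh (a - b) = cosh a * cosh b - sinh a * sinh b.
Proof.
  unfold cosh, sinh.
  replace (a - b) with (a + - b) by ring.
  replace (- (a + - b)) with (- a + b) by ring.
  rewrite !exp_plus; field.
Qed.

Lemma sinh_minus a b : sinh (a - b) = sinh a * cosh b - cosh a * sinh b.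
Proof.
  unfold cosh, sinh.
  replace (a - b) with (a + - b) by ring.
  replace (- (a + - b)) with (- a + b) by ring.
  rewrite !exp_plus; field.
Qed.

Lemma cosh_sqr a : cosh a * cosh a = 1 + sinh a * sinh a.
Proof.
  pose proof (cosh_minus a a) as E.
  replace (a - a) with 0 in E by ring; rewrite cosh_0 in E; lra.
Qed.

Lemma cosh_half a : cosh a = 1 + 2 * (sinh (a / 2) * sinh (a / 2)).
Proof.
  pose proof (cosh_minus (a / 2) (- (a / 2))) as E.
  pose proof (cosh_sqr (a / 2)).
  assert (cosh (- (a / 2)) = cosh (a / 2)) as E1
    by (unfold cosh; rewrite Ropp_involutive; field).
  assert (sinh (- (a / 2)) = - sinh (a / 2)) as E2
    by (unfold sinh; rewrite Ropp_involutive; field).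
  rewrite E1, E2 in E.
  replace (a / 2 - - (a / 2)) with a in E by field; lra.
Qed.

Lemma cosh_ge_1 a : 1 <= cosh a.
Proof. rewrite cosh_half; nra. Qed.

Lemma sinh_pos a : 0 < a -> 0 < sinh a.
Proof. intros h; pose proof (sinh_lt 0 a h) as h'; now rewrite sinh_0 in h'. Qed.

Lemma sinh_le a b : a <= b -> sinh a <= sinh b.
Proof. intros [h| ->]; [left; now apply sinh_lt | right; easy]. Qed.

Lemma sinh_nonneg a : 0 <= a -> 0 <= sinh a.
Proof. intros h; pose proof (sinh_le 0 a h) as h'; now rewrite sinh_0 in h'. Qed.

Lemma cosh_lt a b : 0 <= a -> a < b -> cosh a < cosh b.
Proof.
  intros h h'; rewrite (cosh_half a), (cosh_half b).
  pose proof (sinh_nonneg (a / 2)); pose proof (sinh_lt (a / 2) (b / 2)); nra.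
Qed.

Lemma cosh_le a b : 0 <= a -> a <= b -> cosh a <= cosh b.
Proof. intros h [h'| ->]; [left; now apply cosh_lt | right; easy]. Qed.

Lemma cosh_le_inv a b : 0 <= b -> cosh a <= cosh b -> a <= b.
Proof.
  intros h h'; apply Rnot_lt_le; intros h2.
  pose proof (cosh_lt b a h h2); lra.
Qed.

Lemma cosh_abs a : cosh (Rabs a) = cosh a.
Proof.
  unfold Rabs; destruct Rcase_abs; [|easy].
  unfold cosh; rewrite Ropp_involutive; field.
Qed.

Lemma sinh_ge_id a : 0 <= a -> a <= sinh a.
Proof.
  intros [h| <-]; [|rewrite sinh_0; lra].
  destruct (MVT_cor2 sinh cosh 0 a h) as [c [E _]].
  - intros; apply derivable_pt_lim_sinh.
  - rewrite sinh_0 in E; pose proof (cosh_ge_1 c); nra.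
Qed.

Lemma cosh_ge_sqr a : 0 <= a -> a * a / 2 <= cosh a - 1.
Proof.
  intros h; rewrite cosh_half.
  pose proof (sinh_ge_id (a / 2)); nra.
Qed.

Lemma sinh_le_exp a : sinh a <= exp a / 2.
Proof. unfold sinh; pose proof (exp_pos (- a)); lra. Qed.

Lemma exp_le a b : a <= b -> exp a <= exp b.
Proof. intros [h| ->]; [left; now apply exp_increasing | right; easy]. Qed.

Lemma sinh_superadditive p q : 0 < p -> 0 < q -> sinh p + sinh q < sinh (p + q).
Proof.
  intros hp hq.
  assert (E : sinh (p + q) = sinh p * cosh q + cosh p * sinh q).
  { unfold sinh, cosh; rewrite Ropp_plus_distr, !exp_plus; field. }
  rewrite E.
  pose proof (sinh_pos p hp); pose proof (sinh_pos q hq).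
  pose proof (cosh_ge_1 p).
  pose proof (cosh_lt 0 q (Rle_refl 0) hq) as h; rewrite cosh_0 in h; nra.
Qed.

Lemma cosh_minus_1_le s : 0 < s -> cosh s - 1 <= s * sinh s.
Proof.
  intros h; destruct (MVT_cor2 cosh sinh 0 s h) as [c [E hc]].
  - intros; apply derivable_pt_lim_cosh.
  - rewrite cosh_0 in E; pose proof (sinh_lt c s); nra.
Qed.

(** Five squarings starting from [1 + 11/160 <= exp (11/160)]. The value 8 gives the ratio 1/8 of
    the geometric series of corrections. *)
Lemma exp_11_5_ge : 8 <= exp (11 / 5).
Proof.
  assert (hd : forall a b c, b <= exp a -> 0 <= b -> c <= b * b -> c <= exp (a + a)).
  { intros a b c h h0 h1; rewrite exp_plus; nra. }
  pose proof (exp_ineq1_le (11 / 160)) as h.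
  apply (hd _ _ (1142 / 1000)) in h; [|lra|lra].
  apply (hd _ _ (1304 / 1000)) in h; [|lra|lra].
  apply (hd _ _ (17 / 10)) in h; [|lra|lra].
  apply (hd _ _ (289 / 100)) in h; [|nra|nra].
  apply (hd _ _ 8) in h; [|nra|nra].
  eapply Rle_trans; [exact h|right; f_equal; field].
Qed.

Lemma exp_ge_8_mul a b : b + 11 / 5 <= a -> 8 * exp b <= exp a.
Proof.
  intros h; apply Rle_trans with (exp (11 / 5) * exp b).
  - apply Rmult_le_compat_r; [left; apply exp_pos | apply exp_11_5_ge].
  - rewrite <- exp_plus; apply exp_le; lra.
Qed.

(** By convexity the extreme value is at [t = 11/5], where it is at most [11/5 + 1/8]. The bound
    [12/5] is twice the depth [6/5]: within time [11/5] before [R], the lower bound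
    [6/5 - (R - t) - exp (t - R)] still exceeds [- (6/5)]. *)
Lemma add_exp_neg_lt t : 0 <= t <= 11 / 5 -> t + exp (- t) < 12 / 5.
Proof.
  intros ht.
  pose proof (exp_ge_8_mul 0 (- (11 / 5)) ltac:(lra)) as h8; rewrite exp_0 in h8.
  set (s := 11 / 5 - t).
  assert (E : exp (- (11 / 5)) = exp (- t) * exp (- s)).
  { rewrite <- exp_plus; f_equal; unfold s; ring. }
  pose proof (exp_ineq1_le (- s)); pose proof (exp_pos (- t)).
  assert (exp (- t) <= 1) by (rewrite <- exp_0; apply exp_le; lra).
  assert (0 <= s) by (unfold s; lra).
  assert (exp (- t) * (1 - s) <= exp (- (11 / 5))) by (rewrite E; nra).
  unfold s in *; nra.
Qed.

Lemma lipschitz_continuity (g : R -> R) :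
  (forall a b, g a - g b <= Rabs (a - b)) -> continuity g.
Proof.
  intros h a e he; exists e; split; [easy|].
  intros b [_ hb]; unfold R_dist in *; simpl in *; unfold R_dist in *.
  pose proof (h a b); pose proof (h b a); rewrite (Rabs_minus_sym a b) in *.
  apply Rabs_def1; lra.
Qed.

(** Retraction of the line onto [[0, l]]. It extends functions on a segment to all of [R], since the
    extreme and intermediate value theorems used here ask for two-sided continuity at the ends as
    well. *)
Definition clamp (l t : R) : R := Rmax 0 (Rmin t l).

Lemma clamp_in l t : 0 <= l -> 0 <= clamp l t <= l.
Proof.
  intros; unfold clamp, Rmax, Rmin.
  destruct (Rle_dec t l); destruct Rle_dec; lra.
Qed.

Lemma clamp_id l t : 0 <= t <= l -> clamp l t = t.
Proof.
  intros; unfold clamp, Rmax, Rmin.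
  destruct (Rle_dec t l); destruct Rle_dec; lra.
Qed.

Lemma clamp_lipschitz l s t : 0 <= l -> Rabs (clamp l s - clamp l t) <= Rabs (s - t).
Proof.
  intros; unfold clamp, Rmax, Rmin.
  destruct (Rle_dec t l), (Rle_dec s l); repeat destruct Rle_dec; unfold Rabs;
  repeat destruct Rcase_abs; lra.
Qed.

Lemma le_of_small_error a b M :
  0 <= M -> (forall e, 0 < e <= 1 / 2 -> a <= b + e * M) -> a <= b.
Proof.
  intros hM h; apply Rnot_lt_le; intros hlt.
  set (e := Rmin (1 / 2) ((a - b) / (2 * (M + 1)))).
  assert (0 < (a - b) / (2 * (M + 1))) by (apply Rdiv_lt_0_compat; lra).
  assert (he : 0 < e <= 1 / 2 /\ e <= (a - b) / (2 * (M + 1)))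
    by (unfold e, Rmin; destruct Rle_dec; lra).
  specialize (h e (proj1 he)).
  assert (e * (M + 1) <= (a - b) / (2 * (M + 1)) * (M + 1))
    by (apply Rmult_le_compat_r; lra).
  replace ((a - b) / (2 * (M + 1)) * (M + 1)) with ((a - b) / 2) in * by (field; lra).
  lra.
Qed.

(** * Limits along an ultrafilter *)

(** A single ultrafilter containing all tails yields limits at all times [t] at once, which replaces
    the diagonal extraction of an Arzela-Ascoli argument. *)
Definition free_ultrafilter (U : (nat -> Prop) -> Prop) : Prop :=
  ~ U (fun _ => False) /\
  (forall P Q, U P -> U Q -> U (fun n => P n /\ Q n)) /\
  (forall P Q : nat -> Prop, (forall n, P n -> Q n) -> U P -> U Q) /\
  (forall P, U P \/ U (fun n => ~ P n)) /\
  (forall N, U (fun n => (N <= n)%nat)).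

Lemma free_ultrafilter_exists : exists U, free_ultrafilter U.
Proof.
  set (F := fun P : nat -> Prop => exists N, forall n, (N <= n)%nat -> P n).
  assert (HF : filter.ProperFilter F).
  { split.
    - intros [N h]; exact (h N (le_n N)).
    - split.
      + now exists 0%nat.
      + intros P Q [N h] [M h']; exists (Nat.max N M).
        intros n hn; split; [apply h | apply h']; lia.
      + intros P Q hPQ [N h]; exists N; intros n hn; apply hPQ, h, hn. }
  destruct (filter.ultraFilterLemma HF) as [U [hU hFU]]; exists U.
  destruct (filter.ultra_proper (UltraFilter := hU)) as [h0 [hT hI hS]].
  repeat split.
  - exact h0.
  - intros P Q; apply hI.
  - intros P Q; apply hS.
  - intros P; apply (filter.in_ultra_setVsetC P hU).
  - intros N; apply hFU; now exists N.
Qed.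

Section Comparison.
Variable X : Type.
Variable d : X -> X -> R.
Hypothesis Hmet : is_metric X d.

Lemma metric_nonneg x y : 0 <= d x y.
Proof. apply Hmet. Qed.

Lemma metric_refl x : d x x = 0.
Proof. now apply Hmet. Qed.

Lemma metric_sym x y : d x y = d y x.
Proof. apply Hmet. Qed.

Lemma metric_tri x y z : d x z <= d x y + d y z.
Proof. apply Hmet. Qed.

Lemma metric_pos x y : x <> y -> 0 < d x y.
Proof.
  intros h; destruct (metric_nonneg x y) as [h'|h']; [easy|].
  exfalso; apply h, Hmet; easy.
Qed.

Definition ulim (U : (nat -> Prop) -> Prop) (u : nat -> X) (z : X) : Prop :=
  forall e, 0 < e -> U (fun n => d (u n) z < e).

Section Ultralimit.
Variable U : (nat -> Prop) -> Prop.
Hypothesis HU : free_ultrafilter U.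

Lemma ultra_inhabited P : U P -> exists n, P n.
Proof.
  destruct HU as [h0 [_ [hS _]]]; intros hP.
  apply NNPP; intros h; apply h0; revert hP; apply hS.
  intros n hn; apply h; now exists n.
Qed.

Lemma ultra_and P Q : U P -> U Q -> U (fun n => P n /\ Q n).
Proof. apply HU. Qed.

Lemma ultra_mono (P Q : nat -> Prop) : U P -> (forall n, P n -> Q n) -> U Q.
Proof. intros h h'; revert h; now apply HU. Qed.

Lemma ultra_ge N : U (fun n => (N <= n)%nat).
Proof. apply HU. Qed.

Lemma ultra_not_list {I : Type} (P : I -> nat -> Prop) (l : list I) :
  (forall i, ~ U (P i)) -> U (fun n => forall i, In i l -> ~ P i n).
Proof.
  intros h; induction l as [|i l IH].
  - apply ultra_mono with (1 := ultra_ge 0); simpl; tauto.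
  - assert (hi : U (fun n => ~ P i n)).
    { destruct HU as [_ [_ [_ [h2 _]]]]; destruct (h2 (P i)) as [hP|hP]; [now destruct (h i) | easy]. }
    apply ultra_mono with (1 := ultra_and _ _ hi IH).
    intros n [h1 h2] j [<-|hj]; auto.
Qed.

(** If no point were a limit, every point would have a ball that [u] visits only on a set of indices
    outside [U]. Finitely many such balls cover the closed ball, and the intersection of the
    complements, still in [U], contains an index whose point is covered by none. *)
Lemma bounded_has_ulim (Hprop : proper X d) (u : nat -> X) x r :
  U (fun n => d x (u n) <= r) -> exists z, ulim U u z.
Proof.
  intros hb; apply NNPP; intros hno.
  assert (hz : forall z, exists e, 0 < e /\ ~ U (fun n => d (u n) z < e)).
  { intros z; apply NNPP; intros h; apply hno; exists z; intros e he.
    apply NNPP; intros h'; apply h; now exists e. }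
  destruct (Hprop x r X (fun z y => d y z < proj1_sig
    (constructive_indefinite_description _ (hz z)))) as [l hl].
  - intros z y; destruct constructive_indefinite_description as [e [he he2]]; simpl.
    intros h; exists (e - d y z); split; [lra|]; unfold open_ball; intros w hw.
    pose proof (metric_tri w y z); rewrite (metric_sym w y) in *; lra.
  - intros z _; exists z; destruct constructive_indefinite_description as [e [he he2]].
    simpl; now rewrite metric_refl.
  - pose proof (ultra_not_list (fun z n => d (u n) z < proj1_sig
      (constructive_indefinite_description _ (hz z))) l) as hl2.
    destruct (ultra_inhabited _ (ultra_and _ _ hb (hl2 (fun z =>
      proj2 (proj2_sig (constructive_indefinite_description _ (hz z)))))))
      as [n [h1 h2]].
    destruct (hl (u n) h1) as [z [hz1 hz2]]; exact (h2 z hz1 hz2).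
Qed.

Lemma ulim_dist_le u v z w c :
  ulim U u z -> ulim U v w -> U (fun n => d (u n) (v n) <= c) -> d z w <= c.
Proof.
  intros hu hv h; apply Rnot_lt_le; intros hlt.
  set (e := (d z w - c) / 2).
  assert (he : 0 < e) by (unfold e; lra).
  destruct (ultra_inhabited _ (ultra_and _ _ h (ultra_and _ _ (hu e he) (hv e he))))
    as [n [h1 [h2 h3]]].
  pose proof (metric_tri z (u n) w); pose proof (metric_tri (u n) (v n) w).
  rewrite (metric_sym z (u n)) in *; unfold e in *; lra.
Qed.

Lemma ulim_dist_ge u v z w c :
  ulim U u z -> ulim U v w -> U (fun n => c <= d (u n) (v n)) -> c <= d z w.
Proof.
  intros hu hv h; apply Rnot_lt_le; intros hlt.
  set (e := (c - d z w) / 2).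
  assert (he : 0 < e) by (unfold e; lra).
  destruct (ultra_inhabited _ (ultra_and _ _ h (ultra_and _ _ (hu e he) (hv e he))))
    as [n [h1 [h2 h3]]].
  pose proof (metric_tri (u n) z (v n)); pose proof (metric_tri z w (v n)).
  rewrite (metric_sym w (v n)) in *; unfold e in *; lra.
Qed.

Lemma ulim_dist_eq u v z w c :
  ulim U u z -> ulim U v w -> U (fun n => d (u n) (v n) = c) -> d z w = c.
Proof.
  intros hu hv h; apply Rle_antisym.
  - apply ulim_dist_le with u v; auto; apply ultra_mono with (1 := h); intros; lra.
  - apply ulim_dist_ge with u v; auto; apply ultra_mono with (1 := h); intros; lra.
Qed.

Lemma ulim_cst z : ulim U (fun _ => z) z.
Proof. intros e he; apply ultra_mono with (1 := ultra_ge 0); intros; now rewrite metric_refl. Qed.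

Lemma ulim_lipschitz_le (f : X -> R) u z c :
  (forall y y', f y - f y' <= d y y') ->
  ulim U u z -> U (fun n => f (u n) <= c) -> f z <= c.
Proof.
  intros hf hu h; apply Rnot_lt_le; intros hlt.
  assert (he : 0 < f z - c) by lra.
  destruct (ultra_inhabited _ (ultra_and _ _ h (hu _ he))) as [n [h1 h2]].
  pose proof (hf z (u n)); rewrite (metric_sym z (u n)) in *; lra.
Qed.

End Ultralimit.

(** * Comparison with the hyperbolic plane and convexity along geodesics *)

Hypothesis Hcat : CAT_minus1 X d.
Hypothesis Hgeod : geodesic_space X d.

Lemma segment_dist c x y t : geodesic_segment X d c x y -> 0 <= t <= d x y -> d x (c t) = t.
Proof.
  intros [h [h0 h1]] ht; rewrite <- h0 at 1; rewrite h by (pose proof (metric_nonneg x y); lra).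
  rewrite Rabs_left1; lra.
Qed.

Lemma isometric_segment c T :
  0 <= T -> isometric_on X d c 0 T -> geodesic_segment X d c (c 0) (c T) /\ d (c 0) (c T) = T.
Proof.
  intros hT h.
  assert (E : d (c 0) (c T) = T) by (rewrite h by lra; rewrite Rabs_left1; lra).
  repeat split; try rewrite E; auto.
Qed.

Lemma ray_isometric r T : geodesic_ray X d r -> isometric_on X d r 0 T.
Proof. intros h u v hu hv; apply h; lra. Qed.

(** The comparison at equal times, with the identity [1 - cos gamma = (cosh c - cosh (a - b)) /
    (sinh a * sinh b)] and denominators cleared. *)
Lemma fan x y z c1 c2 t :
  x <> y -> x <> z ->
  geodesic_segment X d c1 x y -> geodesic_segment X d c2 x z ->
  0 <= t <= d x y -> 0 <= t <= d x z ->
  (cosh (d (c1 t) (c2 t)) - 1) * (sinh (d x y) * sinh (d x z)) <=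
  sinh t * sinh t * (cosh (d y z) - cosh (d x y - d x z)).
Proof.
  intros hy hz h1 h2 ht1 ht2.
  pose proof (Hcat x y z c1 c2 hy hz h1 h2 t t ht1 ht2) as h; cbv zeta in h.
  pose proof (sinh_pos _ (metric_pos x y hy)) as sy.
  pose proof (sinh_pos _ (metric_pos x z hz)) as sz.
  rewrite cosh_minus, cosh_sqr in *.
  set (p := sinh (d x y) * sinh (d x z)) in *.
  assert (hp : 0 < p) by now apply Rmult_lt_0_compat.
  apply Rle_trans with (((1 + sinh t * sinh t -
     sinh t * sinh t * ((cosh (d x y) * cosh (d x z) - cosh (d y z)) / p)) - 1) * p).
  - apply Rmult_le_compat_r; lra.
  - right; field; lra.
Qed.

(** A hyperbolic Stewart inequality: take the comparison at the far end [z] of the second segment,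
    so that [sinh (d x z)] cancels. The degenerate case [x = z], outside [CAT_minus1], is an
    equality. *)
Lemma cosh_dist_side x y z c s :
  x <> y -> geodesic_segment X d c x y -> 0 <= s <= d x y ->
  cosh (d (c s) z) * sinh (d x y) <=
  cosh (d x z) * sinh (d x y - s) + cosh (d y z) * sinh s.
Proof.
  intros hy h hs.
  pose proof (sinh_pos _ (metric_pos x y hy)) as sy.
  destruct (classic (x = z)) as [<-|hz].
  - rewrite metric_refl, (metric_sym (c s)), (segment_dist c x y) by easy.
    rewrite cosh_0, (metric_sym y x), sinh_minus; lra.
  - destruct (Hgeod x z) as [c2 h2].
    pose proof (metric_nonneg x z).
    assert (hh : 0 <= d x z <= d x z) by lra.
    pose proof (Hcat x y z c c2 hy hz h h2 s (d x z) hs hh) as hc; cbv zeta in hc.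
    destruct h2 as [_ [_ E]]; rewrite E in hc.
    pose proof (sinh_pos _ (metric_pos x z hz)) as sz.
    rewrite sinh_minus.
    apply Rmult_le_compat_r with (r := sinh (d x y)) in hc; [|lra].
    apply Rle_trans with (1 := hc); right; field; lra.
Qed.

(** Integrated form of [phi'' >= phi] along geodesics: the right side divided by [sinh (v - u)] is
    the solution of [h'' = h] with the same values at the ends. *)
Definition sinh_convex (phi : X -> R) : Prop :=
  forall c u v s, u < v -> isometric_on X d c u v -> u <= s <= v ->
    phi (c s) * sinh (v - u) <= phi (c u) * sinh (v - s) + phi (c v) * sinh (s - u).

Lemma cosh_dist_sinh_convex z : sinh_convex (fun y => cosh (d y z)).
Proof.
  intros c u v s huv h hs.
  assert (hiso : isometric_on X d (fun t => c (u + t)) 0 (v - u)).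
  { intros a b ha hb; rewrite h by lra; f_equal; lra. }
  destruct (isometric_segment _ (v - u) ltac:(lra) hiso) as [h1 E].
  replace (u + 0) with u in * by ring; replace (u + (v - u)) with v in * by ring.
  pose proof (cosh_dist_side (c u) (c v) z (fun t => c (u + t)) (s - u)) as hh.
  rewrite E in hh; simpl in hh.
  replace (u + (s - u)) with s in hh by ring.
  replace (v - u - (s - u)) with (v - s) in hh by ring.
  apply hh; [|easy|lra].
  intros e; rewrite e, metric_refl in E; lra.
Qed.

(** * Signed depth functions *)

(* [f] is the signed depth in a ball or horoball; [phi], a decreasing function of [f]
   ([cosh d(center, .)] or [exp (- f)]), carries the curvature information. *)
Record depth_function (f phi : X -> R) : Prop := {
  depth_lipschitz : forall y z, f y - f z <= d y z;
  depth_order : forall y z, phi y <= phi z <-> f z <= f y;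
  depth_pos : forall y, 0 < phi y;
  depth_convex : sinh_convex phi }.

Section Depth.
Variables f phi : X -> R.
Hypothesis Hf : depth_function f phi.

(** Otherwise [phi (c s)] would dominate both end values, while the weights [sinh (v - s)] and
    [sinh (s - u)] have sum strictly below [sinh (v - u)]; this contradicts [phi > 0]. *)
Lemma depth_quasiconcave c u v s :
  isometric_on X d c u v -> u < s < v -> f (c u) < f (c s) \/ f (c v) < f (c s).
Proof.
  intros h hs; apply NNPP; intros hn; apply not_or_and in hn; destruct hn as [h1 h2].
  apply Rnot_lt_le, (depth_order _ _ Hf) in h1.
  apply Rnot_lt_le, (depth_order _ _ Hf) in h2.
  pose proof (depth_convex _ _ Hf c u v s ltac:(lra) h ltac:(lra)) as hc.
  pose proof (sinh_superadditive (v - s) (s - u) ltac:(lra) ltac:(lra)) as hs2.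
  replace (v - s + (s - u)) with (v - u) in hs2 by ring.
  pose proof (depth_pos _ _ Hf (c s)).
  pose proof (sinh_pos (v - s)); pose proof (sinh_pos (s - u)); nra.
Qed.

Lemma depth_between c u v s k :
  isometric_on X d c u v -> u <= s <= v -> k <= f (c u) -> k <= f (c v) -> k <= f (c s).
Proof.
  intros h [[hu| <-] [hv| ->]] h1 h2; auto.
  destruct (depth_quasiconcave c u v s h (conj hu hv)); lra.
Qed.

(** Convexity at the midpoint, where [phi] is at least [phi (c T)], together with
    [1 + T / 2 <= 2 * cosh (T / 2)]. It bounds the time needed to reach a given depth for the first
    time. *)
Lemma depth_time_bound c T :
  0 <= T -> isometric_on X d c 0 T -> (forall t, 0 <= t <= T -> f (c t) <= f (c T)) ->
  phi (c T) * T <= 2 * phi (c 0).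
Proof.
  intros [hT| <-] h hmax; [|pose proof (depth_pos _ _ Hf (c 0)); lra].
  pose proof (depth_convex _ _ Hf c 0 T (T / 2) hT h ltac:(lra)) as hc.
  pose proof (proj2 (depth_order _ _ Hf (c T) (c (T / 2))) (hmax (T / 2) ltac:(lra))) as ho.
  assert (E : sinh (T - 0) = 2 * sinh (T / 2) * cosh (T / 2)).
  { replace (T - 0) with (T / 2 + T / 2) by field.
    unfold sinh, cosh; rewrite Ropp_plus_distr, !exp_plus; field. }
  rewrite E in hc.
  replace (T - T / 2) with (T / 2) in hc by field.
  replace (T / 2 - 0) with (T / 2) in hc by field.
  pose proof (sinh_pos (T / 2) ltac:(lra)) as hs.
  assert (hc2 : phi (c (T / 2)) * (2 * cosh (T / 2)) <= phi (c 0) + phi (c T)).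
  { apply Rmult_le_reg_r with (sinh (T / 2)); lra. }
  assert (hcosh : 1 + T / 2 <= 2 * cosh (T / 2)).
  { unfold cosh; pose proof (exp_ineq1_le (T / 2)); pose proof (exp_pos (- (T / 2))); lra. }
  pose proof (depth_pos _ _ Hf (c T)).
  pose proof (depth_pos _ _ Hf (c (T/2))); nra.
Qed.

End Depth.
End Comparison.

(** * Projections and shadows *)

Section Shadows.
Variable X : Type.
Variable d : X -> X -> R.
Hypothesis Hmet : is_metric X d.
Hypothesis Hcat : CAT_minus1 X d.
Hypothesis Hgeod : geodesic_space X d.

Lemma dist_ge_sub x y z : d x y - d x z <= d y z.
Proof. pose proof (metric_tri _ _ Hmet x z y); rewrite (metric_sym _ _ Hmet z y) in *; lra. Qed.

Lemma cosh_sub_le x y z : cosh (d x y - d x z) <= cosh (d y z).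
Proof.
  rewrite <- cosh_abs; apply cosh_le; [apply Rabs_pos|].
  pose proof (dist_ge_sub x y z); pose proof (dist_ge_sub x z y).
  rewrite (metric_sym _ _ Hmet z y) in *; unfold Rabs; destruct Rcase_abs; lra.
Qed.

Lemma same_time_dist_le x y z c1 c2 t :
  geodesic_segment X d c1 x y -> geodesic_segment X d c2 x z ->
  0 <= t <= d x y -> 0 <= t <= d x z -> d (c1 t) (c2 t) <= d y z.
Proof.
  intros h1 h2 hy hz.
  destruct (Rle_lt_or_eq_dec 0 t (proj1 hy)) as [ht| <-].
  2:{ destruct h1 as [_ [-> _]], h2 as [_ [-> _]].
      rewrite (metric_refl _ _ Hmet); apply (metric_nonneg _ _ Hmet). }
  assert (hxy : x <> y) by (intros <-; rewrite (metric_refl _ _ Hmet) in hy; lra).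
  assert (hxz : x <> z) by (intros <-; rewrite (metric_refl _ _ Hmet) in hz; lra).
  pose proof (fan X d Hmet Hcat x y z c1 c2 t hxy hxz h1 h2 hy hz) as h.
  pose proof (cosh_sub_le x y z) as hc.
  pose proof (cosh_ge_1 (d x y - d x z)).
  pose proof (sinh_pos t ht).
  pose proof (sinh_le t (d x y) (proj2 hy)).
  pose proof (sinh_le t (d x z) (proj2 hz)).
  apply cosh_le_inv; [apply (metric_nonneg _ _ Hmet)|].
  assert (sinh t * sinh t <= sinh (d x y) * sinh (d x z)) by nra.
  assert (0 < sinh (d x y) * sinh (d x z)) by nra.
  assert (cosh (d (c1 t) (c2 t)) - 1 <= cosh (d y z) - cosh (d x y - d x z)); [|lra].
  apply Rmult_le_reg_r with (sinh (d x y) * sinh (d x z)); nra.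
Qed.

(** Points at equal times are compared while both segments last. Beyond time [d x z] the point [z]
    itself serves: [cosh] of the distance to [z] is convex on the remaining piece and at most
    [cosh (d y z)] at both its ends. *)
Lemma segment_near_segment x y z c1 c2 t :
  geodesic_segment X d c1 x y -> geodesic_segment X d c2 x z -> 0 <= t <= d x y ->
  exists t', 0 <= t' <= d x z /\ d (c1 t) (c2 t') <= d y z.
Proof.
  intros h1 h2 ht.
  pose proof (metric_nonneg _ _ Hmet x z) as hz0.
  destruct (Rle_lt_dec t (d x z)) as [hz|hz].
  - exists t; split; [lra|]; apply same_time_dist_le with x; auto; lra.
  - exists (d x z); split; [lra|].
    assert (hb : d (c1 (d x z)) (c2 (d x z)) <= d y z)
      by (apply same_time_dist_le with x; auto; lra).
    assert (Ez : c2 (d x z) = z) by apply h2.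
    assert (Ey : c1 (d x y) = y) by apply h1.
    rewrite Ez in *.
    assert (hi : isometric_on X d c1 (d x z) (d x y)).
    { intros u v hu hv; apply h1; lra. }
    pose proof (cosh_dist_sinh_convex X d Hmet Hcat Hgeod z c1 (d x z) (d x y) t
      ltac:(lra) hi ltac:(lra)) as hc; simpl in hc; rewrite Ey in hc.
    apply cosh_le_inv; [apply (metric_nonneg _ _ Hmet)|].
    pose proof (cosh_le _ _ (metric_nonneg _ _ Hmet _ _) hb).
    pose proof (cosh_ge_1 (d y z)).
    pose proof (sinh_nonneg (d x y - t) ltac:(lra)).
    pose proof (sinh_pos (t - d x z) ltac:(lra)).
    pose proof (sinh_pos (d x y - d x z) ltac:(lra)).
    assert (sinh (d x y - t) + sinh (t - d x z) <= sinh (d x y - d x z)).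
    { destruct (Rle_lt_or_eq_dec t (d x y) (proj2 ht)) as [hlt| ->].
      - pose proof (sinh_superadditive (d x y - t) (t - d x z) ltac:(lra) ltac:(lra)) as hs.
        replace (d x y - t + (t - d x z)) with (d x y - d x z) in hs by ring; lra.
      - rewrite Rminus_diag, sinh_0; lra. }
    apply Rmult_le_reg_r with (sinh (d x y - d x z)); nra.
Qed.

Section Depth.
Variables f phi : X -> R.
Hypothesis Hf : depth_function X d f phi.

Lemma depth_along_lipschitz c l s t : 0 <= l -> isometric_on X d c 0 l ->
  f (c (clamp l s)) - f (c (clamp l t)) <= Rabs (s - t).
Proof.
  intros hl h; apply Rle_trans with (1 := depth_lipschitz _ _ _ _ Hf _ _).
  rewrite h by now apply clamp_in.
  now apply clamp_lipschitz.
Qed.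

Lemma depth_max_on_segment c l : 0 <= l -> isometric_on X d c 0 l ->
  exists T, 0 <= T <= l /\ forall t, 0 <= t <= l -> f (c t) <= f (c T).
Proof.
  intros hl h.
  destruct (continuity_ab_maj (fun t => f (c (clamp l t))) 0 l hl) as [T [hT hT2]].
  - intros t _; apply lipschitz_continuity; intros; now apply depth_along_lipschitz.
  - exists T; split; [easy|]; intros t ht.
    specialize (hT t ht); now rewrite !clamp_id in hT.
Qed.

(** [D y] is the maximal depth along a chosen segment from [x] to [y]. Its Lipschitz property, from
    [segment_near_segment], allows an intermediate value argument on the endpoint [y]. *)
Lemma max_depth_exists x :
  exists D : X -> R,
    (forall y, exists c T, geodesic_segment X d c x y /\ 0 <= T <= d x y /\ f (c T) = D y /\
       forall t, 0 <= t <= d x y -> f (c t) <= D y) /\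
    (forall y y', D y - D y' <= d y y').
Proof.
  assert (h : forall y, exists v c T, geodesic_segment X d c x y /\ 0 <= T <= d x y /\
     f (c T) = v /\ forall t, 0 <= t <= d x y -> f (c t) <= v).
  { intros y; destruct (Hgeod x y) as [c hc].
    destruct (depth_max_on_segment c (d x y) (metric_nonneg _ _ Hmet _ _)) as [T hT];
      [apply hc|].
    exists (f (c T)), c, T; intuition. }
  set (D := fun y => proj1_sig (constructive_indefinite_description _ (h y))).
  assert (hD : forall y, exists c T, geodesic_segment X d c x y /\ 0 <= T <= d x y /\
    f (c T) = D y /\ forall t, 0 <= t <= d x y -> f (c t) <= D y).
  { intros y; unfold D; now destruct constructive_indefinite_description as [v hv]. }
  exists D; split; [easy|].
  intros y y'; destruct (hD y) as [c [T [h1 [h2 [h3 _]]]]].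
  destruct (hD y') as [c' [_ [h1' [_ [_ h4']]]]].
  destruct (segment_near_segment x y y' c c' T h1 h1' h2) as [t' [ht' hd]].
  pose proof (depth_lipschitz _ _ _ _ Hf (c T) (c' t')); specialize (h4' t' ht'); lra.
Qed.

(** Take the supremum of the times up to which the depth stays at most [m]. A depth above [m] there
    would persist a little earlier, and one below [m] a little later, by the Lipschitz property. *)
Lemma depth_first_hit c l m : 0 <= l -> isometric_on X d c 0 l ->
  f (c 0) < m -> m <= f (c l) ->
  exists t, 0 <= t <= l /\ f (c t) = m /\ forall s, 0 <= s <= t -> f (c s) <= m.
Proof.
  intros hl h h0 hm.
  set (E := fun s => 0 <= s <= l /\ forall s', 0 <= s' <= s -> f (c s') <= m).
  assert (hE0 : E 0).
  { split; [lra|]; intros s hs; replace s with 0 by lra; lra. }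
  destruct (completeness E) as [t [hub hlub]].
  - exists l; intros s hs; apply hs.
  - now exists 0.
  - assert (ht0 : 0 <= t) by now apply hub.
    assert (htl : t <= l) by (apply hlub; intros s hs; apply hs).
    assert (hlip : forall a b, 0 <= a <= l -> 0 <= b <= l -> f (c a) - f (c b) <= Rabs (a - b)).
    { intros a b ha hb; rewrite <- h by easy; apply (depth_lipschitz _ _ _ _ Hf). }
    assert (hlt : forall s, 0 <= s < t -> f (c s) <= m).
    { intros s hs; apply NNPP; intros hn.
      assert (t <= s); [|lra].
      apply hlub; intros a [ha ha']; apply Rnot_lt_le; intros hsa.
      apply hn, ha'; lra. }
    assert (hle : f (c t) <= m).
    { apply Rnot_lt_le; intros hgt.
      destruct (Rle_lt_or_eq_dec 0 t ht0) as [hp| <-]; [|lra].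
      set (e := Rmin t ((f (c t) - m) / 2)).
      assert (he : 0 < e /\ e <= t /\ e <= (f (c t) - m) / 2)
        by (unfold e, Rmin; destruct Rle_dec; lra).
      pose proof (hlt (t - e) ltac:(lra)).
      pose proof (hlip t (t - e) ltac:(lra) ltac:(lra)) as hh.
      replace (t - (t - e)) with e in hh by ring; rewrite Rabs_pos_eq in hh; lra. }
    exists t; split; [lra|]; split.
    + apply Rle_antisym; [easy|]; apply Rnot_lt_le; intros hlt2.
      destruct (Rle_lt_or_eq_dec t l htl) as [hp| <-]; [|lra].
      set (e := Rmin (l - t) (m - f (c t))).
      assert (he : 0 < e /\ e <= l - t /\ e <= m - f (c t))
        by (unfold e, Rmin; destruct Rle_dec; lra).
      assert (hEe : E (t + e)).
      { split; [lra|]; intros s hs.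
        destruct (Rlt_le_dec s t) as [hst|hst]; [apply hlt; lra|].
        pose proof (hlip s t ltac:(lra) ltac:(lra)) as hh.
        rewrite Rabs_pos_eq in hh; lra. }
      pose proof (hub _ hEe); lra.
    + intros s hs; destruct (Rle_lt_or_eq_dec s t (proj2 hs)) as [hst| ->]; auto.
      apply hlt; lra.
Qed.

Section Projection.
Variables (x p : X) (m : R).
Hypothesis Hp : m <= f p.
Hypothesis Hclosest : forall z, m <= f z -> d x p <= d x z.

(* First variation at [s -> 0] along [p, k]: the angle at [p] is at least a right angle. *)
Lemma projection_obtuse k : m <= f k -> cosh (d x p) * cosh (d p k) <= cosh (d x k).
Proof.
  intros hk.
  destruct (classic (p = k)) as [<-|hpk].
  { rewrite (metric_refl _ _ Hmet), cosh_0; lra. }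
  destruct (Hgeod p k) as [c hc].
  pose proof (metric_pos _ _ Hmet p k hpk) as hb.
  set (b := d p k) in *.
  (* Apply [cosh_dist_side] at [c s], which lies in [{f >= m}] and hence no closer to [x] than [p],
     then divide by [sinh s] using [cosh s - 1 <= s * sinh s]. *)
  assert (hs : forall s, 0 < s <= b ->
     cosh (d x p) * cosh b - cosh (d x k) <= cosh (d x p) * sinh b * s).
  { intros s hs.
    pose proof (cosh_dist_side X d Hmet Hcat Hgeod p k x c s hpk hc) as h.
    fold b in h; specialize (h ltac:(lra)).
    rewrite sinh_minus, (metric_sym _ _ Hmet k x), (metric_sym _ _ Hmet p x) in h.
    assert (hcs : m <= f (c s)).
    { destruct hc as [hi [h0 h1]]; fold b in hi, h1.
      apply (depth_between X d f phi Hf c 0 b s); [easy|lra|now rewrite h0|now rewrite h1]. }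
    pose proof (Hclosest _ hcs) as hd.
    pose proof (cosh_le _ _ (metric_nonneg _ _ Hmet _ _) hd) as hcd.
    rewrite (metric_sym _ _ Hmet x (c s)) in hcd.
    pose proof (cosh_minus_1_le s (proj1 hs)).
    pose proof (sinh_pos s (proj1 hs)); pose proof (sinh_pos b hb).
    pose proof (cosh_ge_1 (d x p)).
    assert (cosh (d x p) * sinh b <= cosh (d (c s) x) * sinh b) by nra.
    apply Rmult_le_reg_r with (sinh s); [easy|].
    assert (0 <= cosh (d x p) * sinh b * (s * sinh s - (cosh s - 1))).
    { apply Rmult_le_pos; nra. }
    nra. }
  apply Rnot_lt_le; intros hlt.
  set (M := cosh (d x p) * sinh b) in *.
  assert (hM : 0 < M).
  { pose proof (sinh_pos b hb); pose proof (cosh_ge_1 (d x p)); unfold M; nra. }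
  set (D := cosh (d x p) * cosh b - cosh (d x k)) in *.
  assert (hD : 0 < D) by (unfold D; lra).
  set (s := Rmin b (D / (2 * M))).
  assert (0 < D / (2 * M)) by (apply Rdiv_lt_0_compat; lra).
  assert (hss : 0 < s <= b /\ s <= D / (2 * M)) by (unfold s, Rmin; destruct Rle_dec; lra).
  specialize (hs s (proj1 hss)).
  assert (M * s <= M * (D / (2 * M))) by (apply Rmult_le_compat_l; lra).
  replace (M * (D / (2 * M))) with (D / 2) in * by (field; lra); lra.
Qed.

Hypothesis Hx : f x < m.

Lemma projection_dist_pos : 0 < d x p.
Proof. apply (metric_pos _ _ Hmet); intros <-; lra. Qed.

Variables (c q : R -> X) (T : R).
Hypothesis Hc : geodesic_ray X d c.
Hypothesis Hc0 : c 0 = x.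
Hypothesis HT : 0 <= T.
Hypothesis HcT : m <= f (c T).
Hypothesis Hq : geodesic_segment X d q x p.

Lemma projection_dist_le_time : d x p <= T.
Proof.
  pose proof (Hclosest _ HcT) as h.
  rewrite <- Hc0, Hc, Rabs_left1 in h; try rewrite Hc0 in h; lra.
Qed.

(** In the triangle [x], [c T], [p] the angle at [p] is at least right, so [fan] gives a bound
    uniform in [T]: the ray is as close to [[x, p]] as if [c T] were at infinity. *)
Lemma shadow_dist t : 0 <= t <= d x p -> d (c t) (q t) <= exp (t - d x p).
Proof.
  intros ht.
  pose proof projection_dist_pos as hr; pose proof projection_dist_le_time as hrT.
  assert (hxp : x <> p) by (intros e; rewrite <- e, (metric_refl _ _ Hmet) in hr; lra).
  destruct (isometric_segment X d c T HT (ray_isometric X d c T Hc)) as [hs E].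
  rewrite Hc0 in *.
  assert (hxT : x <> c T) by (intros e; rewrite <- e, (metric_refl _ _ Hmet) in E; lra).
  pose proof (fan X d Hmet Hcat x (c T) p c q t hxT hxp hs Hq) as h.
  rewrite E in h; specialize (h ltac:(lra) ht).
  pose proof (projection_obtuse (c T) HcT) as ho; rewrite E, (metric_sym _ _ Hmet p) in ho.
  set (r := d x p) in *; set (b := cosh (d (c T) p)) in *.
  set (D := cosh (d (c t) (q t)) - 1) in *.
  pose proof (sinh_pos r hr) as hsr; pose proof (sinh_pos T ltac:(lra)) as hsT.
  pose proof (sinh_nonneg t (proj1 ht)) as hst.
  pose proof (cosh_ge_1 r) as hcr.
  assert (ecs : forall z, cosh z - sinh z = exp (- z)) by (intros; unfold cosh, sinh; field).
  (* The obtuse angle gives [b * cosh r <= cosh T], and [cosh T - cosh (T - r) * cosh r = sinh r *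
     sinh (T - r)]. *)
  assert (h1 : D * (sinh T * cosh r) <= sinh t * sinh t * sinh (T - r)).
  { apply Rmult_le_reg_r with (sinh r); [easy|].
    apply Rle_trans with (sinh t * sinh t * ((b - cosh (T - r)) * cosh r)).
    { apply Rmult_le_compat_r with (r := cosh r) in h; lra. }
    rewrite (Rmult_assoc (sinh t * sinh t)); apply Rmult_le_compat_l; [nra|].
    pose proof (f_equal (Rmult (cosh T)) (cosh_sqr r)); rewrite cosh_minus, sinh_minus.
    apply Rle_trans with (cosh T - (cosh T * cosh r - sinh T * sinh r) * cosh r); lra. }
  (* [T] disappears through [sinh (T - r) <= sinh T * exp (- r)]. *)
  assert (h2 : D * cosh r <= sinh t * sinh t * exp (- r)).
  { apply Rmult_le_reg_r with (sinh T); [easy|].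
    apply Rle_trans with (sinh t * sinh t * sinh (T - r)); [lra|].
    rewrite (Rmult_assoc (sinh t * sinh t)); apply Rmult_le_compat_l; [nra|].
    rewrite <- ecs, sinh_minus.
    pose proof (ecs T); pose proof (exp_pos (- T)); nra. }
  assert (h3 : D <= exp (t - r) * exp (t - r) / 2).
  { assert (exp r / 2 <= cosh r) by (unfold cosh; pose proof (exp_pos (- r)); lra).
    pose proof (sinh_le_exp t); pose proof (exp_pos r); pose proof (exp_pos (- r)).
    assert (hD0 : 0 <= D) by (unfold D; pose proof (cosh_ge_1 (d (c t) (q t))); lra).
    assert (h4 : sinh t * sinh t <= exp t * exp t / 4) by nra.
    unfold Rminus; rewrite exp_plus.
    assert (h5 : exp r * exp (- r) = 1) by (rewrite <- exp_plus, Rplus_opp_r; apply exp_0).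
    assert (h6 : D * exp r / 2 <= exp t * exp t / 4 * exp (- r)) by nra.
    apply Rmult_le_reg_r with (exp r); [easy|].
    replace (exp t * exp (- r) * (exp t * exp (- r)) / 2 * exp r)
      with (exp t * exp t / 2 * exp (- r) * (exp r * exp (- r))) by field.
    rewrite h5; lra. }
  pose proof (metric_nonneg _ _ Hmet (c t) (q t)) as h0.
  pose proof (cosh_ge_sqr _ h0); fold D in H.
  pose proof (exp_pos (t - r)); nra.
Qed.

Lemma shadow_depth t : 0 <= t <= d x p ->
  m - (d x p - t) - exp (t - d x p) <= f (c t).
Proof.
  intros ht; pose proof (shadow_dist t ht) as h.
  pose proof (depth_lipschitz _ _ _ _ Hf (q t) (c t)) as h1; rewrite (metric_sym _ _ Hmet) in h1.
  pose proof (depth_lipschitz _ _ _ _ Hf p (q t)) as h2.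
  assert (E : d p (q t) = d x p - t).
  { destruct Hq as [hi [_ e]]; rewrite <- e at 1; rewrite hi by lra; apply Rabs_pos_eq; lra. }
  lra.
Qed.

End Projection.

(** Limit of a minimizing sequence along an ultrafilter; the Lipschitz property keeps the limit in
    [{f >= m}]. The least distance is encoded as [- L], with [L] a supremum of opposites. *)
Lemma closest_point_exists (Hprop : proper X d) x y m :
  m <= f y -> exists p, m <= f p /\ forall z, m <= f z -> d x p <= d x z.
Proof.
  intros hy; destruct free_ultrafilter_exists as [U HU].
  destruct (completeness (fun v => exists z, m <= f z /\ v = - d x z)) as [L [hub hlub]].
  - exists 0; intros v [z [_ ->]]; pose proof (metric_nonneg _ _ Hmet x z); lra.
  - now exists (- d x y), y.
  - assert (hn : forall n : nat, exists z, m <= f z /\ d x z < - L + / (INR n + 1)).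
    { intros n; apply NNPP; intros hno.
      assert (hpos : 0 < / (INR n + 1)) by (apply Rinv_0_lt_compat; pose proof (pos_INR n); lra).
      assert (L <= L - / (INR n + 1)); [|lra].
      apply hlub; intros v [z [hz ->]].
      apply Rnot_lt_le; intros h; apply hno; exists z; split; [easy|lra]. }
    set (u := fun n => proj1_sig (constructive_indefinite_description _ (hn n))).
    assert (hu : forall n, m <= f (u n) /\ d x (u n) < - L + / (INR n + 1)).
    { intros n; unfold u; now destruct constructive_indefinite_description. }
    assert (h1 : forall n : nat, / (INR n + 1) <= 1).
    { intros n; rewrite <- Rinv_1; apply Rinv_le_contravar; pose proof (pos_INR n); lra. }
    destruct (bounded_has_ulim X d Hmet U HU Hprop u x (- L + 1)) as [p hp].
    { apply (ultra_mono U HU) with (1 := ultra_ge U HU 0); intros n _.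
      specialize (hu n); specialize (h1 n); lra. }
    exists p; split.
    + cut (- f p <= - m); [lra|].
      apply (ulim_lipschitz_le X d Hmet U HU (fun z => - f z) u p); [|easy|].
      * intros a b; pose proof (depth_lipschitz _ _ _ _ Hf b a) as hl.
        rewrite (metric_sym _ _ Hmet b) in hl; lra.
      * apply (ultra_mono U HU) with (1 := ultra_ge U HU 0); intros n _.
        specialize (hu n); lra.
    + intros z hz; apply Rle_trans with (- L).
      * apply Rnot_lt_le; intros hlt.
        destruct (archimed_cor1 (d x p - - L) ltac:(lra)) as [N [hN hN0]].
        apply (Rlt_irrefl (d x p)).
        apply Rle_lt_trans with (- L + / INR N); [|lra].
        apply (ulim_dist_le X d Hmet U HU (fun _ => x) u); [now apply ulim_cst|easy|].
        apply (ultra_mono U HU) with (1 := ultra_ge U HU N); intros n hn'.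
        specialize (hu n); apply Rle_trans with (- L + / (INR n + 1)); [lra|].
        apply Rplus_le_compat_l, Rinv_le_contravar; [now apply lt_0_INR|].
        apply le_INR in hn'; lra.
      * assert (- d x z <= L) by (apply hub; now exists z); lra.
Qed.

End Depth.
End Shadows.

(** * Tangent rays *)

Section TangentRays.
Variable X : Type.
Variable d : X -> X -> R.
Hypothesis Hmet : is_metric X d.
Hypothesis Hcat : CAT_minus1 X d.
Hypothesis Hgeod : geodesic_space X d.

(** Segments from [x] to far points of [q] converge to the ray from [x] asymptotic to [q]. This
    transfers the path of boundary rays from its own basepoint to [x]. *)
Lemma asymptotic_segment_close x q r T eps :
  geodesic_ray X d r -> r 0 = x -> asymptotic X d q r -> 0 < eps ->
  exists N0, forall N, N0 <= N -> forall c, geodesic_segment X d c x (q N) ->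
    forall t, 0 <= t <= T -> t <= d x (q N) /\ d (c t) (r t) < eps.
Proof.
  intros hr hr0 [C hC] he.
  assert (hC0 : 0 <= C).
  { apply Rle_trans with (2 := hC 0 (Rle_refl 0)); apply (metric_nonneg _ _ Hmet). }
  set (M := sinh T * sinh T * (cosh C - 1)).
  (* With [D = cosh (d (c t) (r t)) - 1], [fan] will give [D * (N - C) <= M]. This threshold makes
     [N - C] exceed [2 * M / (eps * eps)] by at least 1, which is incompatible with
     [D >= eps * eps / 2]. *)
  exists (C + 1 + Rabs T + 2 * M / (eps * eps) + 1); intros N hN c hc t ht.
  assert (hM : 0 <= M).
  { pose proof (cosh_ge_1 C); unfold M; apply Rmult_le_pos; [nra|lra]. }
  assert (hMe : 0 <= 2 * M / (eps * eps)).
  { apply Rmult_le_pos; [lra|]; left; apply Rinv_0_lt_compat; nra. }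
  pose proof (Rle_abs T); pose proof (Rabs_pos T).
  destruct (isometric_segment X d r N ltac:(lra) (ray_isometric X d r N hr)) as [hs E].
  rewrite hr0 in *.
  pose proof (hC N ltac:(lra)) as hCN.
  pose proof (dist_ge_sub X d Hmet x (r N) (q N)) as hge.
  rewrite (metric_sym _ _ Hmet (r N)), E in hge.
  split; [lra|].
  assert (hx1 : x <> q N).
  { intros e; assert (hpos : 0 < d x (q N)) by lra.
    rewrite <- e, (metric_refl _ _ Hmet) in hpos; lra. }
  assert (hx2 : x <> r N).
  { intros e; rewrite <- e, (metric_refl _ _ Hmet) in E; lra. }
  pose proof (fan X d Hmet Hcat x (q N) (r N) c r t hx1 hx2 hc hs ltac:(lra)) as h.
  rewrite E in h; specialize (h ltac:(lra)).
  pose proof (sinh_ge_id (d x (q N)) ltac:(lra)) as hsa.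
  pose proof (sinh_ge_id N ltac:(lra)) as hsb.
  pose proof (cosh_le _ _ (metric_nonneg _ _ Hmet _ _) hCN) as hcC.
  pose proof (cosh_ge_1 (d x (q N) - N)).
  pose proof (sinh_le t T (proj2 ht)); pose proof (sinh_nonneg t (proj1 ht)).
  pose proof (cosh_ge_1 (d (q N) (r N))).
  pose proof (metric_nonneg _ _ Hmet (c t) (r t)) as h0.
  pose proof (cosh_ge_sqr _ h0).
  set (D := cosh (d (c t) (r t)) - 1) in *.
  assert (hDM : D * (N - C) <= M).
  { apply Rle_trans with (D * (sinh (d x (q N)) * sinh N)).
    - apply Rmult_le_compat_l; nra.
    - apply Rle_trans with (1 := h); unfold M.
      assert (sinh t * sinh t <= sinh T * sinh T) by nra.
      apply Rle_trans with (sinh t * sinh t * (cosh C - 1)).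
      + apply Rmult_le_compat_l; nra.
      + apply Rmult_le_compat_r; nra. }
  apply Rnot_le_lt; intros hle.
  assert (hee : eps * eps / 2 <= D) by nra.
  assert (hlt : eps * eps / 2 * (2 * M / (eps * eps) + 1) <= M).
  { apply Rle_trans with (2 := hDM); apply Rmult_le_compat; nra. }
  replace (eps * eps / 2 * (2 * M / (eps * eps) + 1)) with (M + eps * eps / 2) in hlt
    by (field; lra).
  nra.
Qed.

Lemma asymptotic_rays_eq x q r t :
  geodesic_ray X d q -> q 0 = x -> geodesic_ray X d r -> r 0 = x ->
  asymptotic X d q r -> 0 <= t -> q t = r t.
Proof.
  intros hq hq0 hr hr0 ha ht.
  apply Hmet, Rle_antisym; [|apply (metric_nonneg _ _ Hmet)].
  apply Rnot_lt_le; intros hlt.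
  destruct (asymptotic_segment_close x q r t _ hr hr0 ha hlt) as [N0 h].
  set (N := Rmax N0 0).
  assert (hN : N0 <= N) by apply Rmax_l.
  assert (hN' : 0 <= N) by apply Rmax_r.
  destruct (isometric_segment X d q N hN' (ray_isometric X d q N hq)) as [hs _].
  rewrite hq0 in hs.
  pose proof (h N hN q hs t ltac:(lra)); lra.
Qed.

Hypothesis Hext : extendible_geodesics X d.
Hypothesis Hbd : boundary_arcwise_connected X d.

Section Depth.
Variables f phi : X -> R.
Hypothesis Hf : depth_function X d f phi.

(** Extend the segment from [y] to [x] beyond [x]. A later point deeper than [x] would leave [x]
    shallower than points on both sides of it, against quasi-concavity. *)
Lemma ray_away x y : f x < f y ->
  exists r, geodesic_ray X d r /\ r 0 = x /\ forall t, 0 <= t -> f (r t) <= f x.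
Proof.
  intros hxy.
  destruct (Hgeod y x) as [c [hi [h0 h1]]].
  pose proof (metric_nonneg _ _ Hmet y x) as hl0.
  set (l := d y x) in *.
  assert (hl : 0 < l).
  { apply (metric_pos _ _ Hmet); intros ->; lra. }
  destruct (Hext c 0 l ltac:(lra) hi) as [g [hg hgc]].
  assert (hgl : g (l + 0) = x) by (rewrite hgc, Rplus_0_r; [easy|lra]).
  exists (fun t => g (l + t)); split; [|split; [easy|]].
  - intros u v _ _; rewrite hg; f_equal; ring.
  - intros t [ht| <-]; [|rewrite hgl; lra].
    assert (hii : isometric_on X d g 0 (l + t)) by (intros u v _ _; apply hg).
    rewrite Rplus_0_r in hgl.
    destruct (depth_quasiconcave X d f phi Hf g 0 (l + t) l hii ltac:(lra)) as [h|h];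
      rewrite hgl in h; [|lra].
    rewrite (hgc 0), h0 in h by lra; lra.
Qed.

(* The endpoints [p u N] of the path of rays, for a large fixed [N], join in [X] a point whose
   segment from [x] goes deeper than [m] to one whose segment does not; an intermediate
   segment of maximal depth exactly [m] extends beyond its endpoint to the desired ray. *)
Lemma tangent_ray x gam t0 m :
  geodesic_ray X d gam -> gam 0 = x -> 0 <= t0 -> f x < m -> m < f (gam t0) ->
  exists gam' T, geodesic_ray X d gam' /\ gam' 0 = x /\ 0 <= T /\ f (gam' T) = m /\
    forall t, 0 <= t -> f (gam' t) <= m.
Proof.
  intros hg hg0 ht0 hx hm.
  destruct (ray_away x (gam t0) ltac:(lra)) as [eta [he [he0 hfe]]].
  assert (hna : ~ asymptotic X d gam eta).
  { intros ha; pose proof (hfe t0 ht0) as h.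
    rewrite <- (asymptotic_rays_eq x gam eta t0 hg hg0 he he0 ha ht0) in h; lra. }
  destruct Hbd as [x0 hbd].
  destruct (hbd gam eta hg he hna) as [p [hp [hcont [_ [ha0 ha1]]]]].
  (* Uniform bound on the time at which a segment from [x] first attains depth [m], from
     [depth_time_bound] and [phi (gam t0) <= phi (c T)]. *)
  set (Tb := 2 * phi x / phi (gam t0)).
  pose proof (depth_pos _ _ _ _ Hf (gam t0)) as hphi.
  assert (hTb : forall c T, 0 <= T -> isometric_on X d c 0 T -> c 0 = x -> f (c T) = m ->
     (forall t, 0 <= t <= T -> f (c t) <= m) -> T <= Tb).
  { intros c T hT hi hc0 hcT hmax; rewrite <- hcT in hmax.
    pose proof (depth_time_bound X d f phi Hf c T hT hi hmax) as hb; rewrite hc0 in hb.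
    assert (phi (gam t0) <= phi (c T)) by (apply (depth_order _ _ _ _ Hf); lra).
    unfold Tb; apply Rmult_le_reg_r with (phi (gam t0)); [easy|].
    replace (2 * phi x / phi (gam t0) * phi (gam t0)) with (2 * phi x) by (field; lra); nra. }
  destruct (asymptotic_segment_close x (p 0) gam t0 (f (gam t0) - m) hg hg0 ha0 ltac:(lra))
    as [N0 hN0].
  destruct (asymptotic_segment_close x (p 1) eta Tb (m - f x) he he0 ha1 ltac:(lra))
    as [N1 hN1].
  (* Large enough for both end segments to follow [gam] and [eta], and for every [p u N] to be
     farther than [Tb] from [x]. *)
  set (N := Rmax (Rmax N0 N1) (Rmax 0 (Tb + 1 + d x x0))).
  assert (hNs : N0 <= N /\ N1 <= N /\ 0 <= N /\ Tb + 1 + d x x0 <= N).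
  { unfold N, Rmax; repeat destruct Rle_dec; lra. }
  destruct hNs as [hNN0 [hNN1 [hNpos hNb]]].
  destruct (max_depth_exists X d Hmet Hcat Hgeod f phi Hf x) as [D [hD hDl]].
  assert (hfar : forall u, 0 <= u <= 1 -> Tb < d x (p u N)).
  { intros u hu; destruct (hp u hu) as [hr hr0].
    pose proof (dist_ge_sub X d Hmet x0 (p u N) x) as h.
    rewrite <- hr0 in h at 1; rewrite hr, Rabs_left1 in h by lra.
    rewrite (metric_sym _ _ Hmet (p u N)), (metric_sym _ _ Hmet x0) in h; lra. }
  assert (hlip : forall y y', Rabs (D y - D y') <= d y y').
  { intros y y'; pose proof (hDl y y'); pose proof (hDl y' y).
    rewrite (metric_sym _ _ Hmet y' y) in *; unfold Rabs; destruct Rcase_abs; lra. }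
  assert (hc01 : forall u, 0 <= clamp 1 u <= 1) by (intros; apply clamp_in; lra).
  assert (hco : continuity (fun u => m - D (p (clamp 1 u) N))).
  { intros u e hee.
    destruct (hcont (clamp 1 u) (hc01 u) N e hee) as [del [hdel h]].
    exists del; split; [easy|]; intros v [_ hv]; simpl in *; unfold R_dist in *.
    replace (m - D (p (clamp 1 v) N) - (m - D (p (clamp 1 u) N)))
      with (D (p (clamp 1 u) N) - D (p (clamp 1 v) N)) by ring.
    apply Rle_lt_trans with (1 := hlip _ _).
    rewrite (metric_sym _ _ Hmet); apply h; [apply hc01| |lra].
    apply Rle_lt_trans with (2 := hv); apply clamp_lipschitz; lra. }
  assert (h0 : m - D (p (clamp 1 0) N) < 0).
  { rewrite clamp_id by lra.
    destruct (hD (p 0 N)) as [c [T [hc [hT [hcT hmax]]]]].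
    destruct (hN0 N hNN0 c hc t0 ltac:(lra)) as [hl hclose].
    pose proof (hmax t0 ltac:(lra)).
    pose proof (depth_lipschitz _ _ _ _ Hf (gam t0) (c t0)) as h.
    rewrite (metric_sym _ _ Hmet) in h; lra. }
  assert (h1 : 0 < m - D (p (clamp 1 1) N)).
  { rewrite clamp_id by lra.
    destruct (hD (p 1 N)) as [c [T [hc [hT [hcT hmax]]]]].
    apply Rnot_le_lt; intros hle.
    assert (hi : isometric_on X d c 0 T) by (intros u v hu hv; apply hc; lra).
    assert (hc0 : c 0 = x) by apply hc.
    destruct (depth_first_hit X d f phi Hf c T m (proj1 hT) hi) as [t [ht [hft hbef]]];
      [now rewrite hc0|lra|].
    assert (htb : t <= Tb).
    { apply (hTb c); auto; [lra|]; intros u v hu hv; apply hi; lra. }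
    destruct (hN1 N hNN1 c hc t ltac:(lra)) as [_ hclose].
    pose proof (depth_lipschitz _ _ _ _ Hf (c t) (eta t)).
    pose proof (hfe t ltac:(lra)); lra. }
  destruct (IVT _ 0 1 hco ltac:(lra) h0 h1) as [u [hu hDu]].
  rewrite clamp_id in hDu by easy.
  specialize (hfar u hu); set (y := p u N) in *; set (l := d x y) in *.
  destruct (hD y) as [c [T [hc [hT [hcT hmax]]]]]; fold l in hT, hmax.
  destruct hc as [hi [hc0 hcl]]; fold l in hi, hcl.
  pose proof (metric_nonneg _ _ Hmet x y) as hl0; fold l in hl0.
  (* Depth [m] at the far end would be a maximum reached at time [l > Tb]. So the end is strictly
     shallower, and quasi-concavity prevents the extension from going deeper than [m] later. *)
  assert (hy : f (c l) < m).
  { pose proof (hmax l ltac:(lra)) as h.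
    destruct (Rle_lt_or_eq_dec (f (c l)) m ltac:(lra)) as [hlt|heq]; [easy|].
    enough (l <= Tb) by lra.
    apply (hTb c); auto; intros t ht; specialize (hmax t ht); lra. }
  destruct (Hext c 0 l hl0 hi) as [g [hgl hgc]].
  exists g, T; repeat split.
  - intros a b _ _; apply hgl.
  - rewrite hgc by lra; easy.
  - lra.
  - rewrite hgc by lra; lra.
  - intros t ht; destruct (Rle_lt_dec t l) as [htl|htl].
    + rewrite hgc by lra; specialize (hmax t ltac:(lra)); lra.
    + apply Rnot_lt_le; intros hgt.
      assert (m <= f (g l)); [|rewrite hgc in H by lra; lra].
      apply (depth_between X d f phi Hf g T t l); [intros a b _ _; apply hgl|lra| |lra].
      rewrite hgc by lra; lra.
Qed.

End Depth.
End TangentRays.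

(** * Iterated deflection *)

Section Deflection.
Variable X : Type.
Variable d : X -> X -> R.
Hypothesis Hmet : is_metric X d.
Hypothesis Hprop : proper X d.
Hypothesis Hcat : CAT_minus1 X d.
Hypothesis Hgeod : geodesic_space X d.
Hypothesis Hext : extendible_geodesics X d.
Hypothesis Hbd : boundary_arcwise_connected X d.

Lemma pointwise_ulim U (g : nat -> R -> X) :
  free_ultrafilter U ->
  (forall t, exists y r, U (fun n => d y (g n t) <= r)) ->
  exists G, forall t, ulim X d U (fun n => g n t) (G t).
Proof.
  intros HU h.
  assert (hz : forall t, exists z, ulim X d U (fun n => g n t) z).
  { intros t; destruct (h t) as [y [r hb]].
    now apply (bounded_has_ulim X d Hmet U HU Hprop) with y r. }
  exists (fun t => proj1_sig (constructive_indefinite_description _ (hz t))).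
  intros t; now destruct constructive_indefinite_description.
Qed.

Section Family.
Variable I : Type.
Variables F Phi : I -> X -> R.
Hypothesis HF : forall i, depth_function X d (F i) (Phi i).
Hypothesis Hsep : forall i j y, i <> j -> 0 < F i y -> F j y <= - F i y.
Variable x : X.
Hypothesis Hx : forall i, F i x <= 0.

Lemma depth_difference gam i s t : geodesic_ray X d gam -> 0 <= s <= t ->
  F i (gam t) - F i (gam s) <= t - s.
Proof.
  intros hg hs; apply Rle_trans with (1 := depth_lipschitz _ _ _ _ (HF i) _ _).
  rewrite hg by lra; rewrite Rabs_pos_eq; lra.
Qed.

(** In an arbitrary family the infimum of the bad times need not be attained, so take a shape that
    is bad less than 1 after it. If another shape were deeper than [6/5] in between, the depth in
    the chosen one would have to rise by more than [12/5] in time less than 1. The set [E] uses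
    opposite times to turn the infimum into a supremum. *)
Lemma first_deep gam T :
  geodesic_ray X d gam -> 0 <= T ->
  (exists i t, T <= t /\ 6 / 5 < F i (gam t)) ->
  exists i t1, T <= t1 /\ 6 / 5 < F i (gam t1) /\
    forall j t, j <> i -> T <= t <= t1 -> F j (gam t) <= 6 / 5.
Proof.
  intros hg hT [i0 [t0 [ht0 hi0]]].
  set (E := fun s => exists i, T <= - s /\ 6 / 5 < F i (gam (- s))).
  destruct (completeness E) as [L [hub hlub]].
  - exists (- T); intros s [i [hs _]]; lra.
  - exists (- t0), i0; now rewrite Ropp_involutive.
  - assert (hs : exists s, E s /\ L - 1 < s).
    { apply NNPP; intros hno.
      assert (L <= L - 1); [|lra].
      apply hlub; intros s hs; apply Rnot_lt_le; intros hlt; apply hno; now exists s. }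
    destruct hs as [s [[i [hs hi]] hLs]].
    exists i, (- s); split; [easy|split; [easy|]].
    intros j t hj ht; apply Rnot_lt_le; intros hgt.
    assert (- t <= L).
    { apply hub; exists j; rewrite Ropp_involutive; lra. }
    pose proof (Hsep j i (gam t) hj ltac:(lra)).
    pose proof (depth_difference gam i t (- s) hg ltac:(lra)); lra.
Qed.

(** [R] is the distance from [x] to the nearest point of [{F i >= 6/5}]. The factor 2 comes from
    comparing both rays with the segment to that point. *)
Lemma deflection gam i t1 :
  geodesic_ray X d gam -> gam 0 = x -> 0 <= t1 -> 6 / 5 < F i (gam t1) ->
  exists gam' T R, geodesic_ray X d gam' /\ gam' 0 = x /\ 0 < R <= T /\
    F i (gam' T) = 6 / 5 /\ (forall t, 0 <= t -> F i (gam' t) <= 6 / 5) /\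
    (forall t, 0 <= t -> 6 / 5 <= F i (gam t) -> R <= t) /\
    (forall t, 0 <= t <= R -> d (gam t) (gam' t) <= 2 * exp (t - R)) /\
    (forall t, 0 <= t <= R -> 6 / 5 - (R - t) - exp (t - R) <= F i (gam t)) /\
    (forall t, 0 <= t <= R -> 6 / 5 - (R - t) - exp (t - R) <= F i (gam' t)).
Proof.
  intros hg hg0 ht1 hi.
  assert (hx : F i x < 6 / 5) by (specialize (Hx i); lra).
  destruct (closest_point_exists X d Hmet (F i) (Phi i) (HF i) Hprop x (gam t1) (6 / 5)
    ltac:(lra)) as [p [hp hcl]].
  destruct (Hgeod x p) as [q hq].
  destruct (tangent_ray X d Hmet Hcat Hgeod Hext Hbd (F i) (Phi i) (HF i) x gam t1 (6 / 5)
    hg hg0 ht1 hx hi) as [gam' [T [hg' [hg0' [hT [hfT hmax]]]]]].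
  assert (hi1 : 6 / 5 <= F i (gam t1)) by lra.
  assert (hi2 : 6 / 5 <= F i (gam' T)) by lra.
  exists gam', T, (d x p); repeat split; auto.
  - now apply (projection_dist_pos X d Hmet (F i) x p (6 / 5)).
  - now apply (projection_dist_le_time X d (F i) x p (6 / 5) hcl gam').
  - intros t ht hft; now apply (projection_dist_le_time X d (F i) x p (6 / 5) hcl gam).
  - intros t ht.
    pose proof (shadow_dist X d Hmet Hcat Hgeod (F i) (Phi i) (HF i) x p (6 / 5) hp hcl hx
      gam q t1 hg hg0 ht1 hi1 hq t ht).
    pose proof (shadow_dist X d Hmet Hcat Hgeod (F i) (Phi i) (HF i) x p (6 / 5) hp hcl hx
      gam' q T hg' hg0' hT hi2 hq t ht).
    pose proof (metric_tri _ _ Hmet (gam t) (q t) (gam' t)) as htri.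
    rewrite (metric_sym _ _ Hmet (q t)) in htri; lra.
  - intros t ht; now apply (shadow_depth X d Hmet Hcat Hgeod (F i) (Phi i) (HF i) x p (6 / 5)
      hp hcl hx gam q t1).
  - intros t ht; now apply (shadow_depth X d Hmet Hcat Hgeod (F i) (Phi i) (HF i) x p (6 / 5)
      hp hcl hx gam' q T).
Qed.

(* The weight [- 2/7 exp (t - R)] leaves room for all later deflections: if [R + 11/5 <= R'] then
   [2 exp (t - R') + 2/7 exp (t - R') <= 2/7 exp (t - R)]. *)
Definition shallow (gam : R -> X) (T R : R) : Prop :=
  forall j t, 0 <= t <= T ->
    F j (gam t) <= 6 / 5 \/ F j (gam t) <= 6 / 5 + 2 / 7 - 2 / 7 * exp (t - R).

Lemma deflect_first_deep gam T :
  geodesic_ray X d gam -> gam 0 = x -> 0 <= T ->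
  (exists i t, T <= t /\ 6 / 5 < F i (gam t)) ->
  exists i t1 gam' T' R', T <= t1 /\ 6 / 5 < F i (gam t1) /\
    geodesic_ray X d gam' /\ gam' 0 = x /\ 0 < R' <= T' /\ R' <= t1 /\
    F i (gam' T') = 6 / 5 /\ (forall t, 0 <= t -> F i (gam' t) <= 6 / 5) /\
    (forall t, 0 <= t <= R' -> d (gam t) (gam' t) <= 2 * exp (t - R')) /\
    (forall t, 0 <= t <= R' -> 6 / 5 - (R' - t) - exp (t - R') <= F i (gam t)) /\
    (forall R, R + 11 / 5 <= R' -> shallow gam T R -> shallow gam' T' R').
Proof.
  intros hg hg0 hT hbad.
  destruct (first_deep gam T hg hT hbad) as [i [t1 [ht1 [hi hfirst]]]].
  destruct (deflection gam i t1 hg hg0 ltac:(lra) hi)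
    as [gam' [T' [R' [hg' [hg0' [hR [hfT [hmax [hRt [hclose [hd1 hd2]]]]]]]]]]].
  assert (hRt1 : R' <= t1) by (apply hRt; lra).
  exists i, t1, gam', T', R'; do 10 (split; [easy|]).
  intros R hRR hsh j t ht.
  destruct (classic (j = i)) as [ -> | hj]; [left; apply hmax; lra|].
  (* From [R'] to [T'] the depth in shape [i] is at least [1/5], so all other depths are
     negative. *)
  destruct (Rle_lt_dec R' t) as [htR|htR].
  { left.
    assert (h : 1 / 5 <= F i (gam' t)).
    { apply (depth_between X d _ _ (HF i) gam' R' T' t);
        [intros a b ha hb; apply hg'; lra|lra| |lra].
      specialize (hd2 R' ltac:(lra)); rewrite Rminus_diag, exp_0 in hd2; lra. }
    pose proof (Hsep i j (gam' t) (not_eq_sym hj) ltac:(lra)); lra. }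
  (* Just before [R'] the depth in shape [i] still exceeds [- (6/5)], which forbids depth above
     [6/5] elsewhere. *)
  destruct (Rle_lt_dec (R' - 11 / 5) t) as [ht2|ht2].
  { left; apply Rnot_lt_le; intros hgt.
    pose proof (Hsep j i (gam' t) hj ltac:(lra)).
    specialize (hd2 t ltac:(lra)).
    pose proof (add_exp_neg_lt (R' - t) ltac:(lra)) as h.
    replace (- (R' - t)) with (t - R') in h by ring; lra. }
  (* Earlier still, the depth increases by at most [2 * exp (t - R')]. The term [exp (t - R')] is at
     most [1/8] and at most [exp (t - R) / 8], which settles both alternatives of [shallow]. *)
  right.
  pose proof (depth_lipschitz _ _ _ _ (HF j) (gam' t) (gam t)) as hl.
  rewrite (metric_sym _ _ Hmet) in hl.
  pose proof (hclose t ltac:(lra)).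
  pose proof (exp_ge_8_mul 0 (t - R') ltac:(lra)) as h8; rewrite exp_0 in h8.
  pose proof (exp_ge_8_mul (t - R) (t - R') ltac:(lra)) as h8'.
  destruct (Rle_lt_dec t T) as [htT|htT].
  - destruct (hsh j t ltac:(lra)); lra.
  - specialize (hfirst j t hj ltac:(lra)); lra.
Qed.

Section Deflections.
Variable gam0 : R -> X.
Hypothesis Hg0 : geodesic_ray X d gam0.
Hypothesis Hg00 : gam0 0 = x.

(** [R1] is the radius of the first deflection, [R] and [T] belong to the latest one. In the last
    clause [16/7] is the sum of [2 / 8^k], and the subtracted term is the part reserved for later
    deflections; for [R = R1] the bound is [2 * exp (t - R1)]. *)
Definition stage (R1 : R) (gam : R -> X) (T R : R) : Prop :=
  geodesic_ray X d gam /\ gam 0 = x /\ 0 < R1 <= R /\ R <= T /\ shallow gam T R /\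
  (exists i, F i (gam T) = 6 / 5 /\ forall t, 0 <= t -> F i (gam t) <= 6 / 5) /\
  (forall t, 0 <= t <= R1 ->
     d (gam t) (gam0 t) <= 16 / 7 * exp (t - R1) - 2 / 7 * exp (t - R)).

Lemma stage_step R1 gam T R : stage R1 gam T R ->
  (forall j t, T <= t -> F j (gam t) <= 6 / 5) \/
  exists gam' T' R', stage R1 gam' T' R' /\ R + 11 / 5 <= R'.
Proof.
  intros [hg [hg0 [hR1 [hRT [hsh [[i0 [hi0 hmax0]] hclose0]]]]]].
  destruct (classic (exists i t, T <= t /\ 6 / 5 < F i (gam t))) as [hbad|hno].
  2:{ left; intros j t ht; apply Rnot_lt_le; intros h; apply hno; now exists j, t. }
  right.
  destruct (deflect_first_deep gam T hg hg0 ltac:(lra) hbad)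
    as [i [t1 [gam' [T' [R' [ht1 [hi [hg' [hg0' [hR' [hRt [hfT [hmax [hclose [hd hs]]]]]]]]]]]]]]].
  assert (hii : i0 <> i).
  { intros <-; specialize (hmax0 t1 ltac:(lra)); lra. }
  assert (hneg : F i (gam T) <= - (6 / 5)) by (rewrite <- hi0; apply Hsep; [easy|lra]).
  (* At time [T] the ray has depth [6/5] in shape [i0], hence at most [- (6/5)] in shape [i]. A
     smaller [R'] would make it deeper in [i] at [T]: by the shadow estimate if [T <= R'], by
     quasi-concavity between [R'] and [t1] if [R' < T]. *)
  assert (hgap : T + 11 / 5 <= R').
  { destruct (Rle_lt_dec T R') as [hTR|hTR].
    - specialize (hd T ltac:(lra)).
      apply Rnot_lt_le; intros hlt.
      pose proof (add_exp_neg_lt (R' - T) ltac:(lra)) as h.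
      replace (- (R' - T)) with (T - R') in h by ring; lra.
    - specialize (hd R' ltac:(lra)); rewrite Rminus_diag, exp_0 in hd.
      assert (1 / 5 <= F i (gam T)); [|lra].
      apply (depth_between X d _ _ (HF i) gam R' t1 T);
        [intros a b ha hb; apply hg; lra|lra|lra|lra]. }
  exists gam', T', R'; split; [|lra].
  repeat split; try easy; try lra.
  - apply (hs R); [lra|easy].
  - now exists i.
  - intros t ht.
    pose proof (metric_tri _ _ Hmet (gam' t) (gam t) (gam0 t)) as htri.
    rewrite (metric_sym _ _ Hmet (gam' t) (gam t)) in htri.
    pose proof (hclose t ltac:(lra)); pose proof (hclose0 t ht).
    pose proof (exp_ge_8_mul (t - R) (t - R') ltac:(lra)); lra.
Qed.

Lemma long_shallow_ray T1 :
  (forall j t, 0 <= t <= T1 -> F j (gam0 t) <= 0) ->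
  forall n : nat, exists gam, geodesic_ray X d gam /\ gam 0 = x /\
    (forall j t, 0 <= t <= INR n -> F j (gam t) <= 6 / 5 + 2 / 7) /\
    (forall t, 0 <= t <= T1 -> d (gam t) (gam0 t) <= 16 / 7).
Proof.
  intros hT1 n.
  destruct (classic (exists i t, 0 <= t /\ 6 / 5 < F i (gam0 t))) as [hbad|hno].
  2:{ exists gam0; repeat split; auto.
      - intros j t ht; apply Rnot_lt_le; intros h; apply hno; exists j, t; lra.
      - intros t _; rewrite (metric_refl _ _ Hmet); lra. }
  destruct (deflect_first_deep gam0 0 Hg0 Hg00 (Rle_refl 0) hbad)
    as [i [t1 [gam1 [T [R1 [ht1 [hi [hg1 [hg10 [hR [hRt [hfT [hmax [hclose [hd hs]]]]]]]]]]]]]]].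
  (* The initial ray has depth at least [1/5] in shape [i] at time [R1], but no positive depth up to
     [T1]. *)
  assert (hT1R : T1 < R1).
  { apply Rnot_le_lt; intros hle; specialize (hd R1 ltac:(lra)).
    rewrite Rminus_diag, exp_0 in hd; specialize (hT1 i R1 ltac:(lra)); lra. }
  assert (hst : stage R1 gam1 T R1).
  { repeat split; try easy; try lra.
    (* Up to time 0 the initial ray is shallow for any radius; this one is the largest
       admissible. *)
    - apply (hs (R1 - 11 / 5)); [lra|].
      intros j t ht; left; replace t with 0 by lra; rewrite Hg00.
      specialize (Hx j); lra.
    - now exists i.
    - intros t ht; rewrite (metric_sym _ _ Hmet); specialize (hclose t ht); lra. }
  assert (hnear : forall gam T R, stage R1 gam T R ->
     forall t, 0 <= t <= T1 -> d (gam t) (gam0 t) <= 16 / 7).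
  { intros gam T' R [_ [_ [_ [_ [_ [_ hc]]]]]] t ht.
    specialize (hc t ltac:(lra)); pose proof (exp_pos (t - R)).
    assert (exp (t - R1) <= 1) by (rewrite <- exp_0; apply exp_le; lra); lra. }
  assert (hshal : forall gam T R, shallow gam T R ->
     forall j t, 0 <= t <= T -> F j (gam t) <= 6 / 5 + 2 / 7).
  { intros gam T' R h j t ht; pose proof (exp_pos (t - R)); destruct (h j t ht); lra. }
  (* Either the process stops at a ray that is good forever, or each step enlarges the radius by at
     least [11/5], hence by at least 1. *)
  assert (hind : forall n : nat,
     (exists gam, geodesic_ray X d gam /\ gam 0 = x /\
       (forall j t, 0 <= t -> F j (gam t) <= 6 / 5 + 2 / 7) /\
       (forall t, 0 <= t <= T1 -> d (gam t) (gam0 t) <= 16 / 7)) \/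
     exists gam T R, stage R1 gam T R /\ INR n <= R).
  { intros k; induction k as [|k [IH|[gam [T' [R [hs' hk]]]]]].
    - right; exists gam1, T, R1; split; [easy|simpl; lra].
    - now left.
    - destruct (stage_step R1 gam T' R hs') as [hend|[gam' [T'' [R' [hs'' hR']]]]].
      + left; exists gam; split; [apply hs'|split; [apply hs'|split]].
        * intros j t ht; destruct (Rle_lt_dec t T') as [h|h].
          -- apply (hshal gam T' R); [apply hs'|lra].
          -- specialize (hend j t ltac:(lra)); lra.
        * now apply (hnear gam T' R).
      + right; exists gam', T'', R'; split; [easy|]; rewrite S_INR; lra. }
  destruct (hind n) as [[gam [h1 [h2 [h3 h4]]]]|[gam [T' [R [hs' hn]]]]].
  - exists gam; repeat split; auto; intros j t ht; apply h3; lra.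
  - exists gam; split; [apply hs'|split; [apply hs'|split]].
    + intros j t ht; destruct hs' as [_ [_ [_ [hRT [hsh _]]]]].
      apply (hshal gam T' R hsh); lra.
    + now apply (hnear gam T' R).
Qed.

Lemma shallow_ray T1 :
  (forall j t, 0 <= t <= T1 -> F j (gam0 t) <= 0) ->
  exists gam, geodesic_ray X d gam /\ gam 0 = x /\
    (forall j t, 0 <= t -> F j (gam t) <= 6 / 5 + 2 / 7) /\
    (forall t, 0 <= t <= T1 -> d (gam t) (gam0 t) <= 16 / 7).
Proof.
  intros hT1; pose proof (long_shallow_ray T1 hT1) as h.
  set (g := fun n => proj1_sig (constructive_indefinite_description _ (h n))).
  assert (hg : forall n : nat, geodesic_ray X d (g n) /\ g n 0 = x /\
    (forall j t, 0 <= t <= INR n -> F j (g n t) <= 6 / 5 + 2 / 7) /\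
    (forall t, 0 <= t <= T1 -> d (g n t) (gam0 t) <= 16 / 7)).
  { intros n; unfold g; now destruct constructive_indefinite_description. }
  destruct free_ultrafilter_exists as [U HU].
  assert (hall : forall P : nat -> Prop, (forall n, P n) -> U P).
  { intros P hP; apply (ultra_mono U HU) with (1 := ultra_ge U HU 0); auto. }
  (* The rays are controlled only at nonnegative times, whereas the limit is taken at every real
     [t]; [Rabs] fills in the rest. *)
  destruct (pointwise_ulim U (fun n t => g n (Rabs t)) HU) as [G hG].
  { intros t; exists x, (Rabs t); apply hall; intros n.
    destruct (hg n) as [hr [h0 _]]; rewrite <- h0, hr; try apply Rabs_pos; try lra.
    rewrite Rminus_0_l, Rabs_Ropp, Rabs_Rabsolu; lra. }
  assert (hG' : forall t, 0 <= t -> ulim X d U (fun n => g n t) (G t)).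
  { intros t ht; specialize (hG t); now rewrite Rabs_pos_eq in hG. }
  exists G; repeat split.
  - intros u v hu hv; apply (ulim_dist_eq X d Hmet U HU _ _ _ _ _ (hG' u hu) (hG' v hv)).
    apply hall; intros n; now apply (hg n).
  - apply Hmet; apply (ulim_dist_eq X d Hmet U HU _ _ _ _ _ (hG' 0 (Rle_refl 0))
      (ulim_cst X d Hmet U HU x)).
    apply hall; intros n; destruct (hg n) as [_ [-> _]]; apply (metric_refl _ _ Hmet).
  - intros j t ht.
    apply (ulim_lipschitz_le X d Hmet U HU (F j) _ _ _ (depth_lipschitz _ _ _ _ (HF j))
      (hG' t ht)).
    destruct (INR_unbounded t) as [N hN].
    apply (ultra_mono U HU) with (1 := ultra_ge U HU N); intros n hn.
    apply (hg n); apply le_INR in hn; lra.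
  - intros t ht.
    apply (ulim_dist_le X d Hmet U HU _ _ _ _ _ (hG' t (proj1 ht))
      (ulim_cst X d Hmet U HU (gam0 t))).
    apply hall; intros n; now apply (hg n).
Qed.

End Deflections.
End Family.
End Deflection.

(** * Balls and horoballs *)

Section Shapes.
Variable X : Type.
Variable d : X -> X -> R.
Hypothesis Hmet : is_metric X d.
Hypothesis Hcat : CAT_minus1 X d.
Hypothesis Hgeod : geodesic_space X d.

(** The function [t - d y (rho t)] is nondecreasing, so the limit of [d y (rho t) - t] is an
    infimum: an exact lower bound that is eventually almost attained. *)
Definition is_busemann (rho : R -> X) (b : X -> R) : Prop :=
  forall y, (forall t, 0 <= t -> b y <= d y (rho t) - t) /\
    forall e, 0 < e -> exists T, 0 <= T /\ forall t, T <= t -> d y (rho t) - t < b y + e.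

Lemma busemann_exists rho : geodesic_ray X d rho -> exists b, is_busemann rho b.
Proof.
  intros hr.
  assert (h : forall y, exists v, (forall t, 0 <= t -> v <= d y (rho t) - t) /\
    forall e, 0 < e -> exists T, 0 <= T /\ forall t, T <= t -> d y (rho t) - t < v + e).
  { intros y.
    destruct (completeness (fun v => exists t, 0 <= t /\ v = t - d y (rho t))) as [L [hub hlub]].
    - exists (d y (rho 0)); intros v [t [ht ->]].
      pose proof (metric_tri _ _ Hmet (rho 0) y (rho t)) as h.
      rewrite hr, Rabs_left1, (metric_sym _ _ Hmet (rho 0)) in h by lra; lra.
    - exists (0 - d y (rho 0)), 0; split; [lra|easy].
    - exists (- L); split.
      + intros t ht; assert (t - d y (rho t) <= L) by (apply hub; now exists t); lra.
      + intros e he; apply NNPP; intros hno.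
        assert (L <= L - e); [|lra].
        apply hlub; intros v [T [hT ->]]; apply Rnot_lt_le; intros hlt.
        apply hno; exists T; split; [easy|]; intros t ht.
        pose proof (metric_tri _ _ Hmet y (rho T) (rho t)) as h.
        rewrite (hr T t), Rabs_left1 in h by lra; lra. }
  exists (fun y => proj1_sig (constructive_indefinite_description _ (h y))).
  intros y; now destruct constructive_indefinite_description.
Qed.

Section Busemann.
Variables (rho : R -> X) (b : X -> R).
Hypothesis Hrho : geodesic_ray X d rho.
Hypothesis Hb : is_busemann rho b.

Lemma busemann_lipschitz y z : b z - b y <= d y z.
Proof.
  apply le_of_small_error with 1; [lra|]; intros e he.
  destruct (proj2 (Hb y) e ltac:(lra)) as [T [hT h]].
  specialize (h T (Rle_refl T)); pose proof (proj1 (Hb z) T hT).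
  pose proof (metric_tri _ _ Hmet z y (rho T)) as htri.
  rewrite (metric_sym _ _ Hmet z y) in htri; lra.
Qed.

Lemma busemann_limE x y v : busemann_lim X d rho x y v <-> v = b x - b y.
Proof.
  assert (hl : busemann_lim X d rho x y (b x - b y)).
  { intros e he.
    destruct (proj2 (Hb x) e he) as [T1 [hT1 h1]].
    destruct (proj2 (Hb y) e he) as [T2 [hT2 h2]].
    exists (Rmax T1 T2); intros t ht.
    pose proof (Rmax_l T1 T2); pose proof (Rmax_r T1 T2).
    specialize (h1 t ltac:(lra)); specialize (h2 t ltac:(lra)).
    pose proof (proj1 (Hb x) t ltac:(lra)); pose proof (proj1 (Hb y) t ltac:(lra)).
    apply Rabs_def1; lra. }
  split; [|now intros ->].
  intros hv; apply cond_eq; intros e he.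
  destruct (hl (e / 2) ltac:(lra)) as [T1 h1]; destruct (hv (e / 2) ltac:(lra)) as [T2 h2].
  specialize (h1 (Rmax T1 T2) (Rmax_l _ _)); specialize (h2 (Rmax T1 T2) (Rmax_r _ _)).
  apply Rabs_def2 in h1; apply Rabs_def2 in h2; apply Rabs_def1; lra.
Qed.

(** [exp (b y)] is the limit of [2 * exp (- t) * cosh (d y (rho t))], each of which is convex in the
    same sense. *)
Lemma exp_busemann_sinh_convex : sinh_convex X d (fun y => exp (b y)).
Proof.
  intros c u v s huv hc hs.
  pose proof (sinh_pos (v - u) ltac:(lra)) as hS.
  pose proof (sinh_nonneg (v - s) ltac:(lra)) as hp.
  pose proof (sinh_nonneg (s - u) ltac:(lra)) as hq.
  set (p := sinh (v - s)) in *; set (q := sinh (s - u)) in *.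
  pose proof (exp_pos (b (c u))) as hB; pose proof (exp_pos (b (c v))) as hC.
  (* The error splits into [exp e <= 1 + 2 * e], valid for [e <= 1/2], and [exp (- t) <= e], valid
     once [t >= / e]. *)
  assert (hx : forall w e, 0 < e <= 1 / 2 -> exists T, 0 <= T /\ forall t, T <= t ->
     2 * cosh (d w (rho t)) * exp (- t) <= exp (b w) + e * (2 * exp (b w) + 1)).
  { intros w e he; destruct (proj2 (Hb w) e ltac:(lra)) as [T [hT h]].
    exists (T + / e); split; [pose proof (Rinv_0_lt_compat e ltac:(lra)); lra|].
    intros t ht; pose proof (Rinv_0_lt_compat e ltac:(lra)).
    specialize (h t ltac:(lra)).
    assert (E : 2 * cosh (d w (rho t)) * exp (- t) =
      exp (d w (rho t) - t) + exp (- d w (rho t)) * exp (- t)).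
    { unfold cosh, Rminus; rewrite exp_plus; field. }
    rewrite E.
    assert (h1 : exp (d w (rho t) - t) <= exp (b w) * (1 + 2 * e)).
    { apply Rle_trans with (exp (b w + e)); [apply exp_le; lra|].
      rewrite exp_plus; apply Rmult_le_compat_l; [left; apply exp_pos|].
      pose proof (exp_ineq1_le (- e)).
      assert (hee : exp e * exp (- e) = 1) by (rewrite <- exp_plus, Rplus_opp_r; apply exp_0).
      pose proof (exp_pos e); nra. }
    assert (h2 : exp (- t) <= e).
    { pose proof (exp_ineq1_le t).
      assert (hee : exp t * exp (- t) = 1) by (rewrite <- exp_plus, Rplus_opp_r; apply exp_0).
      assert (hie : / e * e = 1) by (apply Rinv_l; lra).
      pose proof (exp_pos (- t)).
      apply Rmult_le_reg_l with (exp t); [apply exp_pos|].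
      rewrite hee; rewrite <- hie; apply Rmult_le_compat_r; lra. }
    assert (h3 : exp (- d w (rho t)) <= 1).
    { rewrite <- exp_0; apply exp_le; pose proof (metric_nonneg _ _ Hmet w (rho t)); lra. }
    pose proof (exp_pos (- t)); nra. }
  apply le_of_small_error with
    ((2 * exp (b (c u)) + 1) * p + (2 * exp (b (c v)) + 1) * q); [nra|].
  intros e he.
  destruct (hx (c u) e he) as [T1 [hT1 h1]]; destruct (hx (c v) e he) as [T2 [hT2 h2]].
  set (t := Rmax T1 T2).
  assert (ht1 : T1 <= t) by apply Rmax_l; assert (ht2 : T2 <= t) by apply Rmax_r.
  specialize (h1 t ht1); specialize (h2 t ht2).
  pose proof (cosh_dist_sinh_convex X d Hmet Hcat Hgeod (rho t) c u v s huv hc hs) as h.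
  simpl in h; fold p q in h.
  pose proof (exp_pos (- t)) as het.
  assert (h0 : exp (b (c s)) <= 2 * cosh (d (c s) (rho t)) * exp (- t)).
  { apply Rle_trans with (exp (d (c s) (rho t) - t)).
    - apply exp_le, Hb; lra.
    - unfold Rminus; rewrite exp_plus; apply Rmult_le_compat_r; [lra|].
      unfold cosh; pose proof (exp_pos (- d (c s) (rho t))); lra. }
  apply Rle_trans with (2 * cosh (d (c s) (rho t)) * exp (- t) * sinh (v - u)).
  { apply Rmult_le_compat_r; lra. }
  apply Rle_trans with (2 * cosh (d (c u) (rho t)) * exp (- t) * p +
    2 * cosh (d (c v) (rho t)) * exp (- t) * q).
  { apply Rmult_le_compat_l with (r := 2 * exp (- t)) in h; lra. }
  apply Rmult_le_compat_r with (r := p) in h1; [|easy].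
  apply Rmult_le_compat_r with (r := q) in h2; [|easy].
  lra.
Qed.

End Busemann.

(** Balls of radius 0 are set apart: such a point may lie deep inside another shape without
    violating disjointness of interiors. *)
Definition has_interior (h : shape X) : Prop :=
  match h with Ball _ r => 0 < r | Horo _ _ _ => True end.

(** The depth is [r - d o y] for a ball and [b o - b y - s] for a horoball. The last clause,
    obtained by moving towards the center, is what turns disjoint interiors into an inequality
    between depths. *)
Lemma shape_depth h : valid_shape X d h ->
  exists f phi, depth_function X d f phi /\
    (forall t y, shape_set X d h t y <-> t <= f y) /\
    (has_interior h -> forall y e, 0 < e -> f y <= 0 ->
       exists z, d y z <= - f y + e /\ 0 < f z).
Proof.
  destruct h as [o r|rho o s]; simpl; intros hv.
  - exists (fun y => r - d o y), (fun y => cosh (d y o)); repeat split.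
    + intros y z; pose proof (metric_tri _ _ Hmet o y z); lra.
    + intros h; rewrite !(metric_sym _ _ Hmet o).
      apply cosh_le_inv in h; [lra|apply (metric_nonneg _ _ Hmet)].
    + intros h; rewrite !(metric_sym _ _ Hmet o) in h.
      apply cosh_le; [apply (metric_nonneg _ _ Hmet)|lra].
    + intros y; pose proof (cosh_ge_1 (d y o)); lra.
    + now apply cosh_dist_sinh_convex.
    + intros [_ h]; lra.
    + pose proof (metric_nonneg _ _ Hmet o y); lra.
    + lra.
    + intros hr y e he hy.
      destruct (Hgeod o y) as [c hc].
      set (t := r - Rmin e r).
      assert (ht : 0 <= t < r /\ r - e <= t) by (unfold t, Rmin; destruct Rle_dec; lra).
      exists (c t); rewrite (segment_dist X d Hmet c o y t hc) by lra.
      split; [|lra].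
      destruct hc as [hi [_ E]]; rewrite <- E at 1.
      rewrite hi by lra; rewrite Rabs_pos_eq; lra.
  - destruct (busemann_exists rho hv) as [b hb].
    exists (fun y => b o - b y - s), (fun y => exp (b y)); repeat split.
    + intros y z; pose proof (busemann_lipschitz rho b hb y z); lra.
    + intros [h|h]; [apply exp_lt_inv in h; lra|apply exp_inv in h; lra].
    + intros h; apply exp_le; lra.
    + intros y; apply exp_pos.
    + now apply exp_busemann_sinh_convex with rho.
    + intros [v [h1 h2]]; apply (busemann_limE rho b hb) in h1; lra.
    + intros h; exists (b o - b y); split; [now apply (busemann_limE rho b hb)|lra].
    + intros _ y e he hy.
      set (t := - (b o - b y - s) + e).
      destruct (proj2 (hb y) (e / 2) ltac:(lra)) as [T0 [hT0 h]].
      (* Far enough for the segment towards [rho T] to have length at least [t]; moving by [t] along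
         it gains depth more than [t - e / 2]. *)
      set (T := T0 + (t + d y (rho 0))).
      pose proof (metric_nonneg _ _ Hmet y (rho 0)).
      assert (hTT : T0 <= T) by (unfold T, t; lra).
      specialize (h T hTT).
      pose proof (metric_tri _ _ Hmet (rho 0) y (rho T)) as htri.
      rewrite hv, Rabs_left1, (metric_sym _ _ Hmet (rho 0)) in htri by lra.
      destruct (Hgeod y (rho T)) as [c hc].
      assert (htd : 0 <= t <= d y (rho T)) by (unfold T, t in *; lra).
      exists (c t); rewrite (segment_dist X d Hmet c y (rho T) t hc htd).
      split; [unfold t; lra|].
      pose proof (proj1 (hb (c t)) T ltac:(lra)) as hbt.
      assert (E : d (c t) (rho T) = d y (rho T) - t).
      { destruct hc as [hi [_ E]]; rewrite <- E at 1.
        rewrite hi by lra; rewrite Rabs_left1; lra. }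
      unfold t in *; lra.
Qed.

Lemma horoball_contains_ray rho o s k : geodesic_ray X d rho ->
  exists t1, 0 <= t1 /\ forall t, t1 <= t -> shape_set X d (Horo rho o s) k (rho t).
Proof.
  intros hr; destruct (busemann_exists rho hr) as [b hb].
  exists (Rmax 0 (s + k - b o)); split; [apply Rmax_l|]; intros t ht.
  pose proof (Rmax_l 0 (s + k - b o)); pose proof (Rmax_r 0 (s + k - b o)).
  exists (b o - b (rho t)); split; [now apply (busemann_limE rho b hb)|].
  pose proof (proj1 (hb (rho t)) t ltac:(lra)) as h.
  rewrite (metric_refl _ _ Hmet) in h; lra.
Qed.

End Shapes.

(** * From disjoint interiors to separated depths, then the ray and the line *)

Theorem theorem4p1 (X : Type) (d : X -> X -> R)
  (Hmet : is_metric X d) (Hprop : proper X d) (Hgeod : geodesic_space X d)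
  (Hcat : CAT_minus1 X d) (Htwo : exists x y : X, x <> y)
  (Hbd : boundary_arcwise_connected X d) (Hext : extendible_geodesics X d)
  (A : Type) (H : A -> shape X)
  (Hvalid : forall a, valid_shape X d (H a))
  (Hdisj : forall a b, a <> b -> forall y,
      ~ (metric_interior X d (shape_set X d (H a) 0) y /\
         metric_interior X d (shape_set X d (H b) 0) y)) :
  (forall x, (forall a, ~ shape_set X d (H a) 0 x) ->
     exists rho, geodesic_ray X d rho /\ rho 0 = x /\
       forall a t, 0 <= t -> ~ shape_set X d (H a) mu0 (rho t)) /\
  (forall a0 rho0 x0 s0, H a0 = Horo rho0 x0 s0 ->
     exists g, geodesic_line X d g /\
       asymptotic X d (fun t => g (- t)) rho0 /\
       forall a, a <> a0 -> forall t, ~ shape_set X d (H a) mu0 (g t)).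
Proof.
  pose proof (fun a => shape_depth X d Hmet Hcat Hgeod (H a) (Hvalid a)) as hex.
  set (f := fun a => proj1_sig (constructive_indefinite_description _ (hex a))).
  assert (hf1 : forall a, exists phi, depth_function X d (f a) phi /\
    (forall t y, shape_set X d (H a) t y <-> t <= f a y) /\
    (has_interior X (H a) -> forall y e, 0 < e -> f a y <= 0 ->
       exists z, d y z <= - f a y + e /\ 0 < f a z)).
  { intros a; unfold f; now destruct constructive_indefinite_description. }
  set (phi := fun a => proj1_sig (constructive_indefinite_description _ (hf1 a))).
  assert (hf : forall a, depth_function X d (f a) (phi a) /\
    (forall t y, shape_set X d (H a) t y <-> t <= f a y) /\
    (has_interior X (H a) -> forall y e, 0 < e -> f a y <= 0 ->
       exists z, d y z <= - f a y + e /\ 0 < f a z)).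
  { intros a; unfold phi; now destruct constructive_indefinite_description. }
  clearbody f phi; clear hex hf1.
  assert (hint : forall a y, 0 < f a y -> metric_interior X d (shape_set X d (H a) 0) y).
  { intros a y hy; exists (f a y); split; [easy|]; unfold open_ball; intros z hz.
    apply (hf a); pose proof (depth_lipschitz _ _ _ _ (proj1 (hf a)) y z); lra. }
  assert (hsep : forall a b y, a <> b -> has_interior X (H b) -> 0 < f a y -> f b y <= - f a y).
  (* If the sum of the two depths at [y] were positive, moving by at most [- f b y] plus half that
     sum would reach a point with both depths positive. *)
  { intros a b y hab hb hy; apply Rnot_lt_le; intros hlt.
    destruct (Rle_lt_dec (f b y) 0) as [hby|hby].
    - destruct (proj2 (proj2 (hf b)) hb y ((f a y + f b y) / 2) ltac:(lra) hby) as [z [hz hbz]].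
      apply (Hdisj a b hab z); split; apply hint; [|easy].
      pose proof (depth_lipschitz _ _ _ _ (proj1 (hf a)) y z); lra.
    - apply (Hdisj a b hab y); split; now apply hint. }
  (* Here [6/5 + 2/7 = 52/35 < 1.534]; a ball of radius 0 contains no point at depth [mu0]. *)
  assert (hmu : forall a y, (has_interior X (H a) -> f a y <= 6 / 5 + 2 / 7) ->
     ~ shape_set X d (H a) mu0 y).
  { intros a y hy hs.
    assert (hi : has_interior X (H a)).
    { destruct (H a); simpl in *; [|easy]; unfold mu0 in hs; lra. }
    apply (hf a) in hs; specialize (hy hi); unfold mu0 in hs; lra. }
  split.
  - intros x hx.
    assert (hxn : forall a, f a x <= 0).
    { intros a; left; apply Rnot_le_lt; intros h; apply (hx a); now apply (hf a). }
    assert (hy : exists y, x <> y).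
    { destruct Htwo as [y [z hyz]].
      destruct (classic (x = y)) as [->|h]; [now exists z|now exists y]. }
    destruct hy as [y hy].
    destruct (Hgeod x y) as [c [hi [hc0 _]]].
    destruct (Hext c 0 (d x y) (metric_nonneg _ _ Hmet _ _) hi) as [g [hg hgc]].
    set (I := {a : A | has_interior X (H a)}).
    destruct (shallow_ray X d Hmet Hprop Hcat Hgeod Hext Hbd I
      (fun i => f (proj1_sig i)) (fun i => phi (proj1_sig i))
      (fun i => proj1 (hf (proj1_sig i)))) with (x := x) (gam0 := g) (T1 := 0)
      as [gam [h1 [h2 [h3 _]]]].
    + intros [a ha] [b hb] z hne hz; simpl in *; apply hsep; auto.
      intros e; apply hne; subst b; f_equal; apply proof_irrelevance.
    + intros i; apply hxn.
    + intros u v _ _; apply hg.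
    + rewrite hgc; [easy|]; pose proof (metric_nonneg _ _ Hmet x y); lra.
    + intros i t ht; replace t with 0 by lra.
      rewrite hgc, hc0; [apply hxn|]; pose proof (metric_nonneg _ _ Hmet x y); lra.
    + exists gam; repeat split; auto; intros a t ht; apply hmu; intros ha.
      now apply (h3 (exist _ a ha)).
  - intros a0 rho0 x0 s0 E.
    assert (hr : geodesic_ray X d rho0) by (specialize (Hvalid a0); now rewrite E in Hvalid).
    (* From time [t1] on, [rho0] has depth at least 1 in its horoball, hence no positive depth in
       the other shapes with interior. *)
    destruct (horoball_contains_ray X d Hmet rho0 x0 s0 1 hr) as [t1 [ht1 hin]].
    assert (hout : forall a t, a <> a0 -> has_interior X (H a) -> t1 <= t -> f a (rho0 t) <= 0).
    { intros a t ha hia ht; specialize (hin t ht); rewrite <- E in hin.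
      apply (hf a0) in hin.
      pose proof (hsep a0 a (rho0 t) (not_eq_sym ha) hia ltac:(lra)); lra. }
    assert (hn : forall n : nat, exists gam, geodesic_ray X d gam /\
      (forall a t, a <> a0 -> 0 <= t -> has_interior X (H a) -> f a (gam t) <= 6 / 5 + 2 / 7) /\
      (forall t, 0 <= t <= INR n -> d (gam t) (rho0 (t1 + INR n - t)) <= 16 / 7)).
    { intros n; pose proof (pos_INR n) as hn0.
      (* The ray [rho0] is run backwards from [rho0 (t1 + n)], and prolonged past [rho0 0] to be a
         full ray. During time [n] it meets only nonpositive depths, so the deflected ray stays
         within [16/7] of it. *)
      destruct (Hext rho0 0 (t1 + INR n) ltac:(lra) (ray_isometric X d _ _ hr)) as [g [hg hgr]].
      set (I := {a : A | a <> a0 /\ has_interior X (H a)}).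
      destruct (shallow_ray X d Hmet Hprop Hcat Hgeod Hext Hbd I
        (fun i => f (proj1_sig i)) (fun i => phi (proj1_sig i))
        (fun i => proj1 (hf (proj1_sig i)))) with (x := rho0 (t1 + INR n))
        (gam0 := fun t => g (t1 + INR n - t)) (T1 := INR n)
        as [gam [h1 [_ [h3 h4]]]].
      - intros [a [ha0 ha]] [b [hb0 hb]] z hne hz; simpl in *; apply hsep; auto.
        intros e; apply hne; subst b; f_equal; apply proof_irrelevance.
      - intros [a [ha0 ha]]; apply hout; auto; lra.
      - intros u v _ _; rewrite hg, Rabs_minus_sym; f_equal; ring.
      - rewrite hgr; [f_equal; ring|lra].
      - intros [a [ha0 ha]] t ht; rewrite hgr by lra; apply hout; auto; lra.
      - exists gam; repeat split; auto.
        + intros a t ha0 ht ha; now apply (h3 (exist _ a (conj ha0 ha))).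
        + intros t ht; specialize (h4 t ht); now rewrite hgr in h4 by lra. }
    set (gs := fun n => proj1_sig (constructive_indefinite_description _ (hn n))).
    assert (hgs : forall n : nat, geodesic_ray X d (gs n) /\
      (forall a t, a <> a0 -> 0 <= t -> has_interior X (H a) -> f a (gs n t) <= 6 / 5 + 2 / 7) /\
      (forall t, 0 <= t <= INR n -> d (gs n t) (rho0 (t1 + INR n - t)) <= 16 / 7)).
    { intros n; unfold gs; now destruct constructive_indefinite_description. }
    destruct free_ultrafilter_exists as [U HU].
    assert (hlarge : forall t, U (fun n => t <= INR n)).
    { intros t; destruct (INR_unbounded t) as [N hN].
      apply (ultra_mono U HU) with (1 := ultra_ge U HU N); intros n h; apply le_INR in h; lra. }
    (* The time shift puts time 0 within [16/7] of [rho0 t1], with negative times leading to the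
       center. For each [t], the indices with [INR n + t < 0] are discarded by the ultrafilter. *)
    destruct (pointwise_ulim X d Hmet Hprop U (fun n t => gs n (INR n + t)) HU) as [g hg].
    { intros t; exists (rho0 t1), (16 / 7 + Rabs t).
      apply (ultra_mono U HU) with (1 := hlarge (- t)); intros n hnt.
      pose proof (pos_INR n) as hn0; destruct (hgs n) as [h1 [_ h2]].
      specialize (h2 (INR n) ltac:(lra)).
      replace (t1 + INR n - INR n) with t1 in h2 by ring.
      pose proof (metric_tri _ _ Hmet (rho0 t1) (gs n (INR n)) (gs n (INR n + t))) as htri.
      rewrite (h1 (INR n)), (metric_sym _ _ Hmet (rho0 t1) (gs n (INR n))) in htri by lra.
      replace (INR n - (INR n + t)) with (- t) in htri by ring.
      rewrite Rabs_Ropp in htri; lra. }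
    exists g; repeat split.
    + intros u v; apply (ulim_dist_eq X d Hmet U HU _ _ _ _ _ (hg u) (hg v)).
      apply (ultra_mono U HU) with
        (1 := ultra_and U HU _ _ (hlarge (- u)) (hlarge (- v))); intros n [hu hv].
      rewrite (proj1 (hgs n)) by lra; f_equal; ring.
    (* [g (- t)] is within [16/7] of [rho0 (t1 + t)], itself at distance [t1] from [rho0 t]. *)
    + exists (16 / 7 + t1); intros t ht.
      pose proof (metric_tri _ _ Hmet (g (- t)) (rho0 (t1 + t)) (rho0 t)) as htri.
      rewrite hr, Rabs_pos_eq in htri by lra.
      assert (d (g (- t)) (rho0 (t1 + t)) <= 16 / 7); [|lra].
      apply (ulim_dist_le X d Hmet U HU _ _ _ _ _ (hg (- t))
        (ulim_cst X d Hmet U HU (rho0 (t1 + t)))).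
      apply (ultra_mono U HU) with (1 := hlarge t); intros n hnt.
      destruct (hgs n) as [_ [_ h2]]; specialize (h2 (INR n + - t) ltac:(lra)).
      now replace (t1 + INR n - (INR n + - t)) with (t1 + t) in h2 by ring.
    + intros a ha t; apply hmu; intros hia.
      apply (ulim_lipschitz_le X d Hmet U HU (f a) _ _ _
        (depth_lipschitz _ _ _ _ (proj1 (hf a))) (hg t)).
      apply (ultra_mono U HU) with (1 := hlarge (- t)); intros n hnt.
      apply (hgs n); auto; lra.
Qed.
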